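(* For every real $r>2$ and every $t$ with $\frac12<t<\frac1{r'}$ there exists a frequency $\lambda$ such that the upper democracy and upper super-democracy functions of $\mathcal B=\{e^{-\lambda_n s}\}$ in $\mathcal H_r^\lambda$ satisfy $$\varphi_u^{r,\lambda}(N)\approx\varphi_{u,\mathcal E}^{r,\lambda}(N)\approx N^t.$$
   Context: A frequency is a strictly increasing unbounded sequence $\lambda=(\lambda_n)_{n\ge1}$ of non-negative real numbers. For $1\le r<\infty$, a $\lambda$-Dirichlet polynomial $D=\sum_{n\in A}a_n e^{-\lambda_n s}$ ($A\subset\mathbb N$ finite, $a_n\in\mathbb C$) has norm $\|D\|_{\mathcal H_r^\lambda}=\lim_{R\to\infty}\big(\frac1{2R}\int_{-R}^R|\sum_{n\in A}a_n e^{-\lambda_n it}|^r\,dt\big)^{1/r}$, and $\mathcal H_r^\lambda$ is the completion of the space of $\lambda$-Dirichlet polynomials under this norm. For a finite set $A\subset\mathbb N$ let $\mathcal E_A$ be the set of families $\varepsilon=(\varepsilon_n)_{n\in A}$ of complex numbers with $|\varepsilon_n|=1$. For $N\in\mathbb N$, with $A$ ranging over finite subsets of $\mathbb N$: $\varphi_u^{r,\lambda}(N)=\sup\{\|\sum_{n\in A}e^{-\lambda_n s}\|_{\mathcal H_r^\lambda}:|A|\le N\}$ and $\varphi_{u,\mathcal E}^{r,\lambda}(N)=\sup\{\|\sum_{n\in A}\varepsilon_n e^{-\lambda_n s}\|_{\mathcal H_r^\lambda}:|A|\le N,\ \varepsilon\in\mathcal E_A\}$. $r'$ is the conjugate exponent,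 $\frac1r+\frac1{r'}=1$. $f(N)\approx g(N)$ means that there are constants $c,C>0$ independent of $N$ with $c\,g(N)\le f(N)\le C\,g(N)$ for all $N\in\mathbb N$. *)

(* Defs.v *)
From HB Require Import structures.
From mathcomp Require Import all_boot all_order all_algebra.
From mathcomp Require Import finmap complex.
From mathcomp Require Import all_classical all_reals all_analysis.

Set Implicit Arguments.
Unset Strict Implicit.
Unset Printing Implicit Defensive.

Import Order.TTheory GRing.Theory Num.Theory.
Import numFieldNormedType.Exports.
Import ComplexField.Normc.

Local Open Scope classical_set_scope.
Local Open Scope ring_scope.
Local Open Scope complex_scope.

Section DirichletPolynomials.
Context {R : realType}.

(* The sequence is indexed from 0: [lam n] is the frequency of index n + 1. *)
Definition is_frequency (lam : nat -> R) : Prop :=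
  [/\ forall n, 0 <= lam n, increasing_seq lam & ~ has_ubound (range lam)].

Definition cexp (z : R[i]) : R[i] :=
  (expR (complex.Re z))%:C * (cos (complex.Im z) +i* sin (complex.Im z)).

(* Only the values of [a] on [A] matter. *)
Definition dirichlet_poly (lam : nat -> R) (A : {fset nat}) (a : nat -> R[i])
    (s : R[i]) : R[i] :=
  \sum_(n <- A) a n * cexp (- (lam n)%:C * s).

(* [normc] is the complex modulus with values in R, whereas [`|z|] is valued
   in R[i]; [`^] is [powR], for which [0 `^ p = 0] when [p != 0]. *)
Definition hnorm (r : R) (lam : nat -> R) (A : {fset nat}) (a : nat -> R[i]) : R :=
  lim ((((2 * T)^-1 * \int[lebesgue_measure]_(t in `[- T, T])
           normc (dirichlet_poly lam A a (0 +i* t)) `^ r) `^ r^-1)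
       @[T --> +oo]).

Definition unimodular_on (A : {fset nat}) (eps : nat -> R[i]) : Prop :=
  forall n, n \in A -> normc (eps n) = 1.

Definition upper_democracy (r : R) (lam : nat -> R) (N : nat) : R :=
  sup [set x | exists2 A : {fset nat},
         (#|` A| <= N)%N & x = hnorm r lam A (fun=> 1)].

Definition upper_super_democracy (r : R) (lam : nat -> R) (N : nat) : R :=
  sup [set x | exists (A : {fset nat}) (eps : nat -> R[i]),
         [/\ (#|` A| <= N)%N, unimodular_on A eps & x = hnorm r lam A eps]].

Definition asymp_equiv (f g : nat -> R) : Prop :=
  exists c C : R, [/\ 0 < c, 0 < C &
    forall N, (0 < N)%N -> c * g N <= f N /\ f N <= C * g N].

End DirichletPolynomials.

(* Main.v *)
Require Import Defs.
From HB Require Import structures.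
From mathcomp Require Import all_boot all_order all_algebra.
From mathcomp Require Import finmap complex.
From mathcomp Require Import all_classical all_reals all_analysis.
From mathcomp Require Import ring lra zify.

Set Implicit Arguments.
Unset Strict Implicit.
Unset Printing Implicit Defensive.

Import Order.TTheory GRing.Theory Num.Theory.
Import numFieldNormedType.Exports.

(** The frequency is a sequence of integers, so the norms are [L^r] norms over
    the circle of sums [f_A] of exponentials with frequencies in a finite set [A].
    Write [r = 2p] and [h = r (1 - t)]; the hypotheses say that [1 < h < r / 2].

    Lower bound.  The sum over [N] nonnegative integers below a multiple of [N^h]
    has modulus of the order of [N] on an interval of length of the order of
    [N^-h], hence norm at least of the order of [N^(1 - h/r) = N^t]
    ([pmean_exp_sum_ge]).

    Upper bound.  Pick one integer at random in each of [N] consecutive intervals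
    of length about [N^(h-1)].  With positive probability [||f_A|| <= C |A|^t]
    for all subsets [A] of the chosen block.  Indeed, let [A] be a minimal
    violator, with [k] elements.  As [L^r] is 2-smooth, [f_A] is well approximated
    by a multiple of [f_s] for a sample [s] of about [k^(2(1-t))] elements of [A]
    ([exp_sum_sample]), which is much less than [k].  By duality and minimality a
    fixed proportion of [A] lies in the large spectrum of [|f_s|^(r-2) f_s], and
    this spectrum has only a small multiple of [k^h] points ([large_spectrum],
    [minimal_bad_set]).  A random block meets so small a set in so many points
    with a probability that is small even compared with the inverse of the number
    of possible samples ([card_bad_functions], [exists_avoiding_function]).

    Blocks of all sizes are then placed one after the other, each translated so
    far that its interaction with the previous ones is negligible, by Bessel's
    inequality.  By 2-smoothness the squared norms of the parts of [A] in the
    blocks add up, and [sum k_j^(2t) <= (sum k_j)^(2t)] as [2t > 1] ([glue]).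

    Unimodular coefficients cost only a constant factor, because a convex function
    of real coefficients in [[0, 1]] is largest at coefficients [0] and [1]
    ([pmean_unimodular]). *)

Local Open Scope classical_set_scope.
Local Open Scope ring_scope.

(** * Means over the circle *)

Section CircleMean.
Context {R : realType}.
Implicit Types (h : R -> R) (a b c : R).
Local Notation mu := (@lebesgue_measure R).

Lemma continuous_integrable_itv h a b : continuous h ->
  mu.-integrable `[a, b] (EFin \o h).
Proof.
move=> ch; apply: continuous_compact_integrable; first exact: segment_compact.
exact: continuous_subspaceT.
Qed.

Lemma Rintegral_itv_split h a b c : continuous h -> a <= b -> b <= c ->
  \int[mu]_(x in `[a, c]) h x =
  \int[mu]_(x in `[a, b]) h x + \int[mu]_(x in `[b, c]) h x.
Proof.
move=> ch ab bc.
have := @Rintegral_itvB R h (BLeft a) (BRight c) b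
  (continuous_integrable_itv a c ch).
rewrite !bnd_simp => /(_ ab bc) /eqP; rewrite subr_eq => /eqP ->.
rewrite addrC; congr (_ + _).
apply: Rintegral_itv_obnd_cbnd.
apply: integrableS (continuous_integrable_itv b c ch) => //.
exact: subset_itv_oc_cc.
Qed.

Lemma Rintegral_itv_subset h a b a' b' : continuous h -> (forall x, 0 <= h x) ->
  a' <= a -> a <= b -> b <= b' ->
  \int[mu]_(x in `[a, b]) h x <= \int[mu]_(x in `[a', b']) h x.
Proof.
move=> ch h0 a'a ab bb'.
rewrite (@Rintegral_itv_split h a' a b') ?(le_trans ab)//.
rewrite (@Rintegral_itv_split h a b b')// addrCA lerDl addr_ge0//;
  exact: Rintegral_ge0.
Qed.

Lemma Rintegral_itv_shift h a b p : continuous h -> a <= b ->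
  \int[mu]_(x in `[a + p, b + p]) h x = \int[mu]_(x in `[a, b]) h (x + p).
Proof.
move=> ch ab; rewrite /Rintegral.
pose F : R -> R := fun x => x + p.
have F1 (x : R) : is_derive x 1 F 1 by apply: is_derive_eq; rewrite addr0.
have F'E : derive1 F = cst 1.
  by apply/funext => x; rewrite derive1E; case: (F1 x).
have cF : continuous F by move=> x; apply: cvgD; [exact: cvg_id|exact: cvg_cst].
rewrite (_ : a + p = F a)// (_ : b + p = F b)//.
rewrite (@integration_by_substitution_increasing _ F h a b ab); first last.
- exact: continuous_subspaceT.
- split; first by move=> x _; case: (F1 x).
  + by apply: cvg_at_right_filter; exact: cF.
  + by apply: cvg_at_left_filter; exact: cF.
- by rewrite F'E; exact: is_cvg_cst.
- by rewrite F'E; exact: is_cvg_cst.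
- by rewrite F'E => x _; exact: cvg_cst.
- by move=> x y _ _ xy; rewrite /F ltrD2r.
by congr fine; apply: eq_integral => x _; rewrite F'E /= mulr1.
Qed.

Definition circle_mean h : R :=
  (2 * pi)^-1 * \int[mu]_(x in `[0, 2 * pi]) h x.
Local Notation mean := circle_mean.

Let pi2_gt0 : 0 < 2 * pi :> R.
Proof. by rewrite mulr_gt0// pi_gt0. Qed.

Lemma meanD h1 h2 : continuous h1 -> continuous h2 ->
  mean (fun x => h1 x + h2 x) = mean h1 + mean h2.
Proof.
move=> c1 c2; rewrite /mean RintegralD ?mulrDr//;
  exact: continuous_integrable_itv.
Qed.

Lemma meanZ c h : continuous h -> mean (fun x => c * h x) = c * mean h.
Proof.
by move=> ch; rewrite /mean RintegralZl 1?mulrCA//; exact: continuous_integrable_itv.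
Qed.

Lemma le_mean h1 h2 : continuous h1 -> continuous h2 ->
  (forall x, h1 x <= h2 x) -> mean h1 <= mean h2.
Proof.
move=> c1 c2 h12; rewrite ler_pM2l ?invr_gt0//.
by apply: le_Rintegral => //; exact: continuous_integrable_itv.
Qed.

Lemma mean_ge0 h : (forall x, 0 <= h x) -> 0 <= mean h.
Proof.
by move=> h0; rewrite mulr_ge0 ?invr_ge0 ?(ltW pi2_gt0)//; exact: Rintegral_ge0.
Qed.

Lemma mean_cst c : mean (fun=> c) = c.
Proof.
rewrite /mean Rintegral_cst//= lebesgue_measure_itv/= lte_fin pi2_gt0.
rewrite -EFinB/= subr0 mulrCA mulVf ?mulr1// gt_eqF//.
Qed.

Lemma mean_sum I (s : seq I) (h : I -> R -> R) :
  (forall i, continuous (h i)) ->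
  mean (fun x => \sum_(i <- s) h i x) = \sum_(i <- s) mean (h i).
Proof.
move=> ch; elim: s => [|i s ih].
  under [X in mean X]funext do rewrite big_nil.
  by rewrite mean_cst big_nil.
under [X in mean X]funext do rewrite big_cons.
rewrite meanD ?big_cons ?ih// => x.
by apply: (cvg_big (op := +%R)) => [|j _]; [exact: add_continuous|exact: ch].
Qed.

Lemma mean_ge_itv h c d : continuous h -> (forall x, 0 <= h x) ->
  0 <= d -> d <= 2 * pi -> (forall x, 0 <= x <= d -> c <= h x) ->
  c * d / (2 * pi) <= mean h.
Proof.
move=> ch h0 d0 d2 ch'; rewrite mulrC ler_pM2l ?invr_gt0//.
apply: le_trans (Rintegral_itv_subset ch h0 (lexx 0) d0 d2).
have -> : c * d = \int[mu]_(x in `[0, d]) c.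
  rewrite Rintegral_cst//= lebesgue_measure_itv/= lte_fin.
  have [d0'|] := ltP 0 d; first by rewrite -EFinB/= subr0.
  by move=> d0'; rewrite (@le_anti _ _ d 0) ?d0' ?d0// mulr0.
apply: le_Rintegral => //.
- by apply: (@continuous_integrable_itv (fun=> c)) => x; exact: cvg_cst.
- exact: continuous_integrable_itv.
Qed.

Lemma mean_cos (n : nat) : mean (fun x => cos (n%:R * x)) = (n == 0)%:R.
Proof.
have [->|n0] := eqVneq n 0.
  under [X in mean X]funext do rewrite mul0r cos0.
  exact: mean_cst.
have nR0 : n%:R != 0 :> R by rewrite pnatr_eq0.
pose F : R -> R := fun x => n%:R^-1 * sin (n%:R * x).
have F1 (x : R) : is_derive x 1 F (cos (n%:R * x)).
  have H : is_derive x 1 (fun x : R => n%:R * x) n%:R.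
    by apply: is_derive_eq; rewrite /GRing.scale/= mulr1.
  rewrite /F; apply: is_derive_eq.
  by rewrite /GRing.scale/= mulrCA mulVf ?mulr1.
have cF : continuous F.
  by move=> x; apply: differentiable_continuous; apply/derivable1_diffP; case: (F1 x).
have cc : continuous (fun x : R => cos (n%:R * x)).
  move=> x; apply: continuous_comp; last exact: continuous_cos.
  by apply: cvgM; [exact: cvg_cst|exact: cvg_id].
rewrite /mean /Rintegral (@continuous_FTC2 _ _ F)//; first last.
- by move=> x _; rewrite derive1E; case: (F1 x).
- split; first by move=> x _; case: (F1 x).
  + by apply: cvg_at_right_filter; exact: cF.
  + by apply: cvg_at_left_filter; exact: cF.
- exact: continuous_subspaceT.
have sinn : sin (n%:R * (2 * pi)) = 0 :> R.
  have -> : n%:R * (2 * pi) = 0 + (pi *+ 2) *+ n :> R.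
    by rewrite add0r -[pi *+ 2]mulr_natl -[RHS]mulr_natl.
  elim: n {n0 nR0 F F1 cF cc} => [|n ih]; first by rewrite addr0 sin0.
  by rewrite mulrSr addrA sinD2pi.
by rewrite /F sinn !mulr0 sin0 mulr0 -EFinB subrr /= mulr0.
Qed.

Lemma shift_periods h (n : nat) : (forall x, h (x + 2 * pi) = h x) ->
  forall x, h (x + n%:R * (2 * pi)) = h x.
Proof.
move=> hp; elim: n => [x|n ih x]; first by rewrite mul0r addr0.
by rewrite -natr1 mulrDl mul1r addrA hp.
Qed.

Lemma Rintegral_periods h (n : nat) : continuous h ->
  (forall x, h (x + 2 * pi) = h x) ->
  \int[mu]_(x in `[0, n%:R * (2 * pi)]) h x =
  n%:R * \int[mu]_(x in `[0, 2 * pi]) h x.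
Proof.
move=> ch hp; elim: n => [|n ih].
  by rewrite !mul0r set_itv1 Rintegral_set1.
have n0 : 0 <= n%:R * (2 * pi) :> R by rewrite mulr_ge0// ltW.
rewrite -natr1 !(mulrDl n%:R 1) !mul1r.
rewrite (@Rintegral_itv_split _ 0 (n%:R * (2 * pi))) ?lerDl ?(ltW pi2_gt0)//.
rewrite ih; congr (_ + _).
have := Rintegral_itv_shift (n%:R * (2 * pi)) ch (ltW pi2_gt0).
rewrite add0r [2 * pi + _]addrC => ->.
by apply: eq_Rintegral => x _; rewrite shift_periods.
Qed.

Lemma Rintegral_periods_sym h (n : nat) : continuous h ->
  (forall x, h (x + 2 * pi) = h x) ->
  \int[mu]_(x in `[- (n%:R * (2 * pi)), n%:R * (2 * pi)]) h x =
  2 * n%:R * \int[mu]_(x in `[0, 2 * pi]) h x.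
Proof.
move=> ch hp.
have n0 : 0 <= n%:R * (2 * pi) :> R by rewrite mulr_ge0// ltW.
rewrite (@Rintegral_itv_split _ _ 0) ?oppr_le0//.
rewrite Rintegral_periods//.
have -> : \int[mu]_(x in `[- (n%:R * (2 * pi)), 0]) h x =
  \int[mu]_(x in `[0, n%:R * (2 * pi)]) h x.
  have := @Rintegral_itv_shift h (- (n%:R * (2 * pi))) 0 (n%:R * (2 * pi)) ch.
  rewrite oppr_le0 addNr add0r => /(_ n0) ->.
  by apply: eq_Rintegral => x _; rewrite shift_periods.
by rewrite Rintegral_periods//; ring.
Qed.

(** A nonnegative periodic function is sandwiched between its integrals over the
    whole numbers of periods just inside and just outside [[-T, T]]; the error
    this makes in the mean is at most the mean over a period times [2 pi / T]. *)
Lemma cvg_symmetric_mean h : continuous h -> (forall x, 0 <= h x) ->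
  (forall x, h (x + 2 * pi) = h x) ->
  (2 * T)^-1 * \int[mu]_(x in `[- T, T]) h x @[T --> +oo] --> mean h.
Proof.
move=> ch h0 hp; set J := \int[mu]_(x in `[0, 2 * pi]) h x.
have J0 : 0 <= J by exact: Rintegral_ge0.
have bnd T : 0 < T -> `|mean h - (2 * T)^-1 * \int[mu]_(x in `[- T, T]) h x| <= J / T.
  move=> T0.
  have T2 : 0 <= T / (2 * pi) by rewrite divr_ge0 ?ltW.
  have /andP[nT Tn] := truncn_itv T2.
  set n := Num.truncn _ in nT Tn.
  have nT' : n%:R * (2 * pi) <= T by rewrite -ler_pdivlMr.
  have Tn' : T <= n.+1%:R * (2 * pi) by rewrite -ler_pdivrMr// ltW.
  have lo : 2 * n%:R * J <= \int[mu]_(x in `[- T, T]) h x.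
    rewrite -Rintegral_periods_sym//; apply: Rintegral_itv_subset => //.
      by rewrite lerN2.
    by have := mulr_ge0 (ler0n R n) (ltW pi2_gt0); lra.
  have hi : \int[mu]_(x in `[- T, T]) h x <= 2 * n.+1%:R * J.
    rewrite -Rintegral_periods_sym//; apply: Rintegral_itv_subset => //.
      by rewrite lerN2.
    by lra.
  rewrite ler_distl /mean -/J.
  set X := \int[mu]_(x in _) _ in lo hi *.
  have T2n : T / (2 * pi) - 1 <= n%:R by rewrite lerBlDr natr1 ltW.
  have lo' : 2 * (T / (2 * pi) - 1) * J <= X.
    by apply: le_trans lo; rewrite ler_wpM2r// ler_pM2l.
  have hi' : X <= 2 * (T / (2 * pi) + 1) * J.
    by apply: le_trans hi _; rewrite ler_wpM2r// ler_pM2l// -natr1 lerD2r.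
  have e0 c : (2 * T)^-1 * (2 * (T / (2 * pi) + c) * J) = (2 * pi)^-1 * J + c * J / T.
    have : pi != 0 :> R by rewrite gt_eqF// pi_gt0.
    by move: (pi : R) => p p0; field; rewrite p0 andbT gt_eqF.
  have e1 := e0 (- 1); have e2 := e0 1; rewrite ?mulN1r ?mulNr mul1r in e1 e2.
  have TT : 0 < (2 * T)^-1 by rewrite invr_gt0 mulr_gt0.
  rewrite -(ler_pM2l TT) e1 in lo'; rewrite -(ler_pM2l TT) e2 in hi'.
  by apply/andP; split; lra.
apply/cvgrPdist_le => e e0; near=> T.
have T0 : 0 < T by near: T; exact: nbhs_pinfty_gt.
apply: le_trans (bnd _ T0) _.
rewrite ler_pdivrMr// mulrC -ler_pdivrMr//.
Unshelve. all: by end_near. Qed.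

End CircleMean.
Notation mean := circle_mean.

(** * Inequalities for real powers *)

Section RealPowers.
Context {R : realType}.
Implicit Types (x y z w a b p : R).

(** Young's inequality with one factor equal to [1]. *)
Lemma powR_bernoulli p z : 1 < p -> 0 <= z -> 1 + p * (z - 1) <= z `^ p.
Proof.
move=> p1 z0.
have p0 : 0 < p by lra.
have := @conjugate_powR R z 1 p (p / (p - 1)) z0 ler01 p0.
rewrite powR1 mulr1 invf_div divr_gt0 ?subr_gt0// => /(_ isT).
have -> : p^-1 + (p - 1) / p = 1 by field; rewrite gt_eqF.
move=> /(_ erefl); rewrite mul1r -(ler_pM2r p0) mulrDl !divfK ?gt_eqF//.
by nra.
Qed.

Lemma powR_tangent p w z : 1 < p -> 0 < w -> 0 <= z ->
  w `^ p + p * w `^ (p - 1) * (z - w) <= z `^ p.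
Proof.
move=> p1 w0 z0.
have zw : 0 <= z / w by rewrite divr_ge0// ltW.
have := powR_bernoulli p1 zw.
rewrite -(ler_pM2r (powR_gt0 p w0)) -powRM// ?divfK ?gt_eqF// ?(ltW w0)//.
apply: le_trans; rewrite le_eqVlt; apply/orP; left; apply/eqP.
rewrite -(@mulr_powRB1 _ w p) ?(ltW w0)//; last lra.
by field; rewrite gt_eqF.
Qed.

Lemma powR_convex p a x y : 1 < p -> 0 <= a -> a <= 1 -> 0 <= x -> 0 <= y ->
  ((1 - a) * x + a * y) `^ p <= (1 - a) * x `^ p + a * y `^ p.
Proof.
move=> p1 a0 a1 x0 y0; set w := _ + _.
have w0 : 0 <= w by rewrite addr_ge0// mulr_ge0// subr_ge0.
have [wz|w_neq0] := eqVneq w 0.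
  rewrite wz powR0; last by apply/eqP; lra.
  by rewrite addr_ge0// mulr_ge0// ?subr_ge0 ?powR_ge0.
have wp : 0 < w by rewrite lt_neqAle eq_sym w_neq0.
have h1 : 0 <= 1 - a by lra.
have := lerD (ler_wpM2l h1 (powR_tangent p1 wp x0)) (ler_wpM2l a0 (powR_tangent p1 wp y0)).
apply: le_trans; rewrite le_eqVlt; apply/orP; left; apply/eqP.
have wE : w = (1 - a) * x + a * y by [].
transitivity (w `^ p + p * w `^ (p - 1) * ((1 - a) * x + a * y - w)).
  by rewrite -wE subrr mulr0 addr0.
by clearbody w; ring.
Qed.

Lemma powR_superadditive p x y : 1 <= p -> 0 <= x -> 0 <= y ->
  x `^ p + y `^ p <= (x + y) `^ p.
Proof.
move=> p1 x0 y0.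
have p0 : 0 < p by lra.
rewrite -!(@mulr_powRB1 _ _ p)// ?addr_ge0// mulrDl.
by apply: lerD; apply: ler_wpM2l => //; apply: ge0_ler_powR => //;
  rewrite ?nnegrE ?subr_ge0 ?addr_ge0 ?lerDl ?lerDr.
Qed.

Lemma weighted_amgm a b x y : 0 < a -> 0 < b -> a + b = 1 -> 0 <= x -> 0 <= y ->
  x `^ a * y `^ b <= a * x + b * y.
Proof.
move=> a0 b0 ab x0 y0.
have := @conjugate_powR R (x `^ a) (y `^ b) a^-1 b^-1 (powR_ge0 _ _) (powR_ge0 _ _).
rewrite !invr_gt0 !invrK => /(_ a0 b0 ab).
by rewrite -!powRrM !mulfV ?gt_eqF// !powRr1// ![_ * a]mulrC ![_ * b]mulrC.
Qed.

(** Second-order Taylor bound for [z `^ p] at [1]: convexity bounds the error by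
    [p (z `^ (p - 1) - 1) (z - 1)], and replacing [p - 1] by a larger integer
    exponent only increases this product. *)
Lemma powR_taylor2 p : 1 < p -> exists C : R, 0 < C /\
  forall z, 0 <= z -> z <= 9 / 4 -> z `^ p <= 1 + p * (z - 1) + C * (z - 1) ^+ 2.
Proof.
move=> p1; have p0 : 0 < p by lra.
pose n := (Num.truncn p).+1.
have pn : p - 1 <= n%:R.
  have /andP[_] := truncn_itv (ltW p0); rewrite -/n; lra.
have B1 : 1 <= (9 / 4) ^+ n :> R by rewrite exprn_ege1//; lra.
have nR : 1 <= n%:R :> R by rewrite ler1n.
have nB : 1 <= n%:R * (9 / 4) ^+ n :> R by rewrite mulr_ege1.
exists (p * (n%:R * (9 / 4) ^+ n)); split; first by rewrite mulr_gt0//; lra.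
move=> z z0 z9.
have [->|zn0] := eqVneq z 0.
  rewrite powR0 ?gt_eqF// sub0r sqrrN expr1n mulr1 mulrN1.
  have : p <= p * (n%:R * (9 / 4) ^+ n) by rewrite ler_peMr// ltW.
  lra.
have zp : 0 < z by rewrite lt_neqAle eq_sym zn0.
have h := powR_tangent p1 zp ler01; rewrite powR1 in h.
have zpE : z `^ p <= 1 + p * (z - 1) + p * ((z `^ (p - 1) - 1) * (z - 1)).
  have -> : 1 + p * (z - 1) + p * ((z `^ (p - 1) - 1) * (z - 1)) =
    1 - p * z `^ (p - 1) * (1 - z) by ring.
  lra.
apply: le_trans zpE _; rewrite lerD2l -mulrA ler_pM2l//.
have h1 : (z `^ (p - 1) - 1) * (z - 1) <= (z ^+ n - 1) * (z - 1).
  rewrite -powR_mulrn//.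
  have [z1|z1] := leP 1 z.
    by rewrite ler_wpM2r ?subr_ge0// lerD2r ler_powR.
  rewrite ler_wnM2r ?subr_le0 ?(ltW z1)// lerD2r.
  by apply: (@ger_powR _ z) => //; rewrite zp ltW.
apply: le_trans h1 _.
rewrite subrX1 mulrAC mulrC -expr2 ler_wpM2r ?sqr_ge0//.
apply: (@le_trans _ _ (\sum_(i < n) (9 / 4) ^+ n)); last first.
  by rewrite sumr_const card_ord (mulr_natl _ n).
apply: ler_sum => i _.
apply: (@le_trans _ _ ((9 / 4) ^+ i)).
  by rewrite lerXn2r// nnegrE; lra.
by apply: ler_weXn2l; [lra|exact: ltnW].
Qed.

(** The scalar form of the expansion of [|u + v| ^ (2p)] around [u], with
    [x = |u|^2], [y = |v|^2] and [d] the inner product of [u] and [v]. *)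
Lemma powR_smooth p : 1 < p -> exists C : R, 1 <= C /\
  forall x y d, 0 <= x -> 0 <= y -> d ^+ 2 <= x * y ->
  (x + 2 * d + y) `^ p <=
  x `^ p + 2 * p * (x `^ (p - 1) * d) + C * (x `^ (p - 1) * y + y `^ p).
Proof.
move=> p1; have p0 : 0 < p by lra.
have [C0 [C00 taylor]] := powR_taylor2 p1.
have P4 : 0 <= 4 * p * 4 `^ (p - 1) by rewrite !mulr_ge0 ?powR_ge0// ltW.
have P10 : 0 <= 10 `^ p :> R by exact: powR_ge0.
pose C := 1 + 10 `^ p + 4 * p * 4 `^ (p - 1) + p + 9 * C0.
exists C; split; first by rewrite /C; lra.
move=> x y d x0 y0 dxy.
have X1 := powR_ge0 x (p - 1); have Yp := powR_ge0 y p; have Xp := powR_ge0 x p.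
have s0 : 0 <= x + 2 * d + y.
  rewrite leNgt; apply/negP => neg.
  have : 0 < (x - y) ^+ 2 \/ 0 <= (x - y) ^+ 2 by right; exact: sqr_ge0.
  have : (x + y) ^+ 2 < (2 * d) ^+ 2.
    rewrite -[ltRHS]sqrrN ltrXn2r ?addr_ge0//; lra.
  have := sqr_ge0 (x - y); nra.
(* If [|u| < 2 |v|], all terms are bounded by multiples of [|v| ^ (2p)]. *)
have [yx|xy] := leP (4 * y) x; last first.
  have yp : 0 < y by lra.
  have d2 : `|d| <= 2 * y.
    rewrite -(ler_pXn2r (n:=2))// ?nnegrE ?normr_ge0 ?mulr_ge0//.
    by rewrite real_normK ?num_real//; nra.
  have l1 : (x + 2 * d + y) `^ p <= 10 `^ p * y `^ p.
    rewrite -powRM//; apply: ge0_ler_powR => //; rewrite ?nnegrE ?mulr_ge0 ?(ltW p0)//.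
    have := ler_norm d; lra.
  have l2 : - (4 * p * 4 `^ (p - 1) * y `^ p) <= 2 * p * (x `^ (p - 1) * d).
    have : x `^ (p - 1) * `|d| <= (4 * y) `^ (p - 1) * (2 * y).
      by apply: ler_pM => //; apply: ge0_ler_powR; rewrite ?nnegrE ?subr_ge0 ?mulr_ge0 ?(ltW p1) ?(ltW xy).
    rewrite powRM// -mulrA [_ `^ _ * (2 * _)]mulrCA [_ `^ _ * y]mulrC mulr_powRB1//.
    rewrite -(ler_pM2l (_ : 0 < 2 * p)) ?mulr_gt0// => h.
    have : 2 * p * (x `^ (p - 1) * - d) <= 2 * p * (x `^ (p - 1) * `|d|).
      by rewrite ler_pM2l ?mulr_gt0// ler_wpM2l// -normrN ler_norm.
    by move: h; lra.
  have l3 : 0 <= x `^ (p - 1) * y by rewrite mulr_ge0.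
  have l4 : (10 `^ p + 4 * p * 4 `^ (p - 1)) * y `^ p <= C * (x `^ (p - 1) * y + y `^ p).
    by rewrite ler_pM ?addr_ge0 ?lerDr// /C; lra.
  lra.
(* Otherwise the ratio [z] of [|u + v|^2] to [|u|^2] is at most [9 / 4]. *)
have [xz|xn0] := eqVneq x 0.
  have y00 : y = 0 by lra.
  have d00 : d = 0.
    by apply/eqP; rewrite -sqrf_eq0; apply/eqP/le_anti; rewrite sqr_ge0 andbT; nra.
  by rewrite xz y00 d00 !mulr0 !addr0 powR0 ?gt_eqF// addr0 !mulr0 addr0.
have xp : 0 < x by rewrite lt_neqAle eq_sym xn0.
have d2 : `|d| <= x / 2.
  rewrite -(ler_pXn2r (n:=2))// ?nnegrE ?normr_ge0 ?divr_ge0//.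
  by rewrite real_normK ?num_real//; nra.
pose z := (x + 2 * d + y) / x.
have z0 : 0 <= z by rewrite divr_ge0.
have z9 : z <= 9 / 4.
  rewrite ler_pdivrMr//; have := ler_norm d; lra.
have := taylor z z0 z9.
rewrite -(ler_pM2r (powR_gt0 p xp)) -powRM ?divfK//.
move/le_trans; apply.
have zx : x * (z - 1) = 2 * d + y by rewrite /z; field.
have xE : x `^ p = x `^ (p - 1) * x by rewrite mulrC mulr_powRB1.
rewrite {1}xE.
have -> : (1 + p * (z - 1) + C0 * (z - 1) ^+ 2) * (x `^ (p - 1) * x) =
  x `^ (p - 1) * x + p * x `^ (p - 1) * (x * (z - 1))
  + C0 * x `^ (p - 1) * (x * (z - 1) ^+ 2) by ring.
rewrite -xE zx.
have l1 : x * (z - 1) ^+ 2 <= 9 * y.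
  rewrite -(ler_pM2l xp) mulrA -expr2 -exprMn zx.
  have := ler_norm d; have := sqr_ge0 (2 * d - y); nra.
have l2 : C0 * x `^ (p - 1) * (x * (z - 1) ^+ 2) <= C0 * x `^ (p - 1) * (9 * y).
  by rewrite ler_wpM2l// mulr_ge0// ltW.
have l3 : 0 <= x `^ (p - 1) * y by rewrite mulr_ge0.
have l4 : (p + 9 * C0) * (x `^ (p - 1) * y) <= C * (x `^ (p - 1) * y + y `^ p).
  rewrite ler_pM// ?lerDl// ?addr_ge0// ?mulr_ge0 ?(ltW p0) ?(ltW C00)// /C; lra.
lra.
Qed.

Lemma continuous_powR_comp (h : R -> R) a : continuous h ->
  (forall x, 0 <= h x) -> 0 < a -> continuous (fun x => h x `^ a).
Proof.
move=> ch h0 a0 x.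
have [hx|hx] := eqVneq (h x) 0.
  rewrite /continuous_at hx powR0 ?gt_eqF//.
  apply/cvgrPdist_lt => e e0.
  have e'0 : 0 < e `^ a^-1 by exact: powR_gt0.
  have /cvgrPdist_lt/(_ _ e'0) := ch x; rewrite hx.
  apply: filterS => y; rewrite !sub0r !normrN !ger0_norm ?powR_ge0// => hy.
  rewrite -[e](@powRr1 _) ?(ltW e0)// -(@mulVf _ a) ?gt_eqF// powRrM.
  by apply: gt0_ltr_powR; rewrite ?nnegrE ?powR_ge0.
have hp : 0 < h x by rewrite lt_neqAle eq_sym hx h0.
apply: (@continuous_comp _ _ _ h (fun y => y `^ a)); first exact: ch.
apply: differentiable_continuous; apply/derivable1_diffP.
by apply: derivable_powR; rewrite in_itv/= hp.
Qed.

End RealPowers.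

Section Holder.
Context {R : realType}.

(** Young's inequality for [f / U] and [g / V], with [U] and [V] positive upper
    bounds for the means, gives the claim with [U] and [V]; these are taken
    arbitrarily small when a mean vanishes. *)
Lemma mean_holder (f g : R -> R) (a b : R) :
  continuous f -> continuous g -> (forall x, 0 <= f x) -> (forall x, 0 <= g x) ->
  0 < a -> 0 < b -> a + b = 1 ->
  mean (fun x => f x `^ a * g x `^ b) <= mean f `^ a * mean g `^ b.
Proof.
move=> cf cg f0 g0 a0 b0 ab.
have key (U V : R) : 0 < U -> 0 < V -> mean f <= U -> mean g <= V ->
    mean (fun x => f x `^ a * g x `^ b) <= U `^ a * V `^ b.
  move=> U0 V0 fU gV.
  have UV : 0 < U `^ a * V `^ b by rewrite mulr_gt0// powR_gt0.
  apply: (@le_trans _ _ (mean (fun x => U `^ a * V `^ b * (a / U * f x + b / V * g x)))).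
    apply: le_mean => [x|x|x].
    - by apply: cvgM; apply: continuous_powR_comp.
    - apply: cvgM; first exact: cvg_cst.
      by apply: cvgD; apply: cvgM; (exact: cvg_cst || exact: cf || exact: cg).
    - have := @weighted_amgm R a b (f x / U) (g x / V) a0 b0 ab.
      rewrite !divr_ge0 ?(ltW U0) ?(ltW V0)// => /(_ isT isT).
      rewrite -(ler_pM2l UV) mulrACA -!powRM ?divr_ge0 ?(ltW U0) ?(ltW V0)//.
      rewrite ![_ * (_ / _) as X in X `^ _]mulrC !divfK ?gt_eqF// => /le_trans; apply.
      by rewrite !mulrA ![_ / _ * _]mulrAC lexx.
  have c1 (k : R) (h : R -> R) : continuous h -> continuous (fun x => k * h x).
    by move=> ch x; apply: cvgM; [exact: cvg_cst|exact: ch].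
  rewrite meanZ; last by move=> x; apply: cvgD; apply: c1.
  rewrite meanD ?meanZ//; try exact: c1.
  rewrite -[leRHS]mulr1 ler_pM2l// -ab.
  by apply: lerD; rewrite mulrAC ler_pdivrMr// ler_pM2l.
have mf := mean_ge0 f0; have mg := mean_ge0 g0.
have small (u e : R) : 0 < u -> 0 < e -> exists2 d, 0 < d & d `^ u <= e.
  move=> u0 e0; exists (e `^ u^-1); first exact: powR_gt0.
  by rewrite -powRrM mulVf ?gt_eqF// powRr1// ltW.
have [fz|fn0] := eqVneq (mean f) 0.
  rewrite fz powR0 ?gt_eqF// mul0r; apply/ler_addgt0Pl => e e0; rewrite addr0.
  pose V := mean g + 1; have V0 : 0 < V by rewrite ltr_wpDl.
  have [d d0 de] := small a (e / V `^ b) a0 (divr_gt0 e0 (powR_gt0 _ V0)).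
  apply: le_trans (key d V d0 V0 _ _) _; rewrite ?fz ?(ltW d0)// ?lerDl//.
  by rewrite -ler_pdivlMr// powR_gt0.
have [gz|gn0] := eqVneq (mean g) 0.
  rewrite gz powR0 ?gt_eqF// mulr0; apply/ler_addgt0Pl => e e0; rewrite addr0.
  pose V := mean f + 1; have V0 : 0 < V by rewrite ltr_wpDl.
  have [d d0 de] := small b (e / V `^ a) b0 (divr_gt0 e0 (powR_gt0 _ V0)).
  apply: le_trans (key V d V0 d0 _ _) _; rewrite ?gz ?(ltW d0)// ?lerDl//.
  by rewrite mulrC -ler_pdivlMr// powR_gt0.
by apply: key => //; rewrite lt_neqAle eq_sym ?fn0 ?gn0.
Qed.

End Holder.

(** * Complex-valued functions and exponentials *)

Section PlaneVectors.
Context {R : realType}.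
Implicit Types (z w : R[i]) (k : R).

Definition sqmod z : R := complex.Re z ^+ 2 + complex.Im z ^+ 2.
Definition dot z w : R := complex.Re z * complex.Re w + complex.Im z * complex.Im w.

Lemma sqmod_ge0 z : 0 <= sqmod z.
Proof. by rewrite addr_ge0// sqr_ge0. Qed.

Lemma sqmod0 : sqmod 0 = 0.
Proof. by rewrite /sqmod /= expr0n/= addr0. Qed.

Lemma sqmodD z w : sqmod (z + w) = sqmod z + 2 * dot z w + sqmod w.
Proof. by case: z => a b; case: w => c d; rewrite /sqmod /dot /=; ring. Qed.

Lemma sqmodM z w : sqmod (z * w) = sqmod z * sqmod w.
Proof. by case: z => a b; case: w => c d; rewrite /sqmod /=; ring. Qed.

Lemma sqmodZ k z : sqmod (k%:C * z)%C = k ^+ 2 * sqmod z.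
Proof. by rewrite sqmodM; congr (_ * _); rewrite /sqmod /= expr0n/= addr0. Qed.

Lemma sqmodN z : sqmod (- z) = sqmod z.
Proof. by case: z => a b; rewrite /sqmod /=; ring. Qed.

Lemma dotzz z : dot z z = sqmod z.
Proof. by rewrite /dot /sqmod !expr2. Qed.

Lemma dot_cauchy z w : dot z w ^+ 2 <= sqmod z * sqmod w.
Proof.
case: z => a b; case: w => c d; rewrite /sqmod /dot /=.
have := sqr_ge0 (a * d - b * c); nra.
Qed.

Lemma dotC z w : dot z w = dot w z.
Proof. by rewrite /dot mulrC [X in _ + X]mulrC. Qed.

Lemma dotDr z w w' : dot z (w + w') = dot z w + dot z w'.
Proof. by case: w => a b; case: w' => c d; rewrite /dot /=; ring. Qed.

Lemma dotBr z w w' : dot z (w - w') = dot z w - dot z w'.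
Proof. by case: w => a b; case: w' => c d; rewrite /dot /=; ring. Qed.

Lemma dotZr z k w : dot z (k%:C * w)%C = k * dot z w.
Proof. by case: z => a b; case: w => c d; rewrite /dot /=; ring. Qed.

Lemma dot0r z : dot z 0 = 0.
Proof. by rewrite /dot /= !mulr0 addr0. Qed.

Lemma dot_sumr I (s : seq I) z (w : I -> R[i]) :
  dot z (\sum_(i <- s) w i) = \sum_(i <- s) dot z (w i).
Proof. exact: (big_morph _ (dotDr z) (dot0r z)). Qed.

Lemma sqmodDle z w : sqmod (z + w) <= 2 * (sqmod z + sqmod w).
Proof.
case: z => a b; case: w => c d; rewrite /sqmod /=.
have := sqr_ge0 (a - c); have := sqr_ge0 (b - d); nra.
Qed.

Lemma dot_le_sqrt z w : dot z w <= Num.sqrt (sqmod z) * Num.sqrt (sqmod w).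
Proof.
apply: le_trans (ler_norm _) _.
by rewrite -sqrtrM ?sqmod_ge0// -sqrtr_sqr ler_wsqrtr// dot_cauchy.
Qed.

Lemma sqmod_sum_le I (s : seq I) (w : I -> R[i]) :
  (forall i, sqmod (w i) <= 1) -> sqmod (\sum_(i <- s) w i) <= (size s)%:R ^+ 2.
Proof.
move=> w1; elim: s => [|i s ih]; first by rewrite big_nil sqmod0 sqr_ge0.
rewrite big_cons sqmodD /=.
have n0 := ler0n R (size s).
have : dot (w i) (\sum_(j <- s) w j) <= (size s)%:R.
  apply: le_trans (dot_le_sqrt _ _) _.
  rewrite -[leRHS]mul1r; apply: ler_pM; rewrite ?sqrtr_ge0//.
    by rewrite -[leRHS]sqrtr1 ler_wsqrtr.
  by rewrite -[leRHS](ger0_norm n0) -sqrtr_sqr ler_wsqrtr.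
have := w1 i; rewrite -natr1; nra.
Qed.

Definition ccontinuous (F : R -> R[i]) : Prop :=
  continuous (fun x => complex.Re (F x)) /\ continuous (fun x => complex.Im (F x)).

Lemma ccontinuousD F G : ccontinuous F -> ccontinuous G ->
  ccontinuous (fun x => F x + G x).
Proof.
move=> [F1 F2] [G1 G2]; split.
  by under eq_fun do rewrite raddfD; move=> x; apply: cvgD; [exact: F1|exact: G1].
by under eq_fun do rewrite raddfD; move=> x; apply: cvgD; [exact: F2|exact: G2].
Qed.

Lemma ccontinuousM F G : ccontinuous F -> ccontinuous G ->
  ccontinuous (fun x => F x * G x).
Proof.
move=> [F1 F2] [G1 G2].
have reM z w : complex.Re (z * w) =
    complex.Re z * complex.Re w - complex.Im z * complex.Im w.
  by case: z => a b; case: w.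
have imM z w : complex.Im (z * w) =
    complex.Re z * complex.Im w + complex.Im z * complex.Re w.
  by case: z => a b; case: w.
split.
  under eq_fun do rewrite reM.
  by move=> x; apply: cvgB; apply: cvgM; (exact: F1 || exact: F2 || exact: G1 || exact: G2).
under eq_fun do rewrite imM.
by move=> x; apply: cvgD; apply: cvgM; (exact: F1 || exact: F2 || exact: G1 || exact: G2).
Qed.

Lemma ccontinuous_cst z : ccontinuous (fun=> z).
Proof. by split => x; exact: cvg_cst. Qed.

Lemma ccontinuousB F G : ccontinuous F -> ccontinuous G ->
  ccontinuous (fun x => F x - G x).
Proof.
move=> cF cG; under [X in ccontinuous X]funext do rewrite -mulN1r.
by apply: ccontinuousD => //; apply: ccontinuousM => //; exact: ccontinuous_cst.
Qed.

Lemma ccontinuous_sum I (s : seq I) (F : I -> R -> R[i]) :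
  (forall i, ccontinuous (F i)) -> ccontinuous (fun x => \sum_(i <- s) F i x).
Proof.
move=> cF; elim: s => [|i s ih].
  by under [X in ccontinuous X]funext do rewrite big_nil; exact: ccontinuous_cst.
by under [X in ccontinuous X]funext do rewrite big_cons; exact: ccontinuousD.
Qed.

Lemma ccontinuous_real (f : R -> R) : continuous f -> ccontinuous (fun x => (f x)%:C)%C.
Proof. by move=> cf; split => // x; exact: cvg_cst. Qed.

Lemma continuous_dot F G : ccontinuous F -> ccontinuous G ->
  continuous (fun x => dot (F x) (G x)).
Proof.
by move=> [F1 F2] [G1 G2] x; apply: cvgD; apply: cvgM;
  (exact: F1 || exact: F2 || exact: G1 || exact: G2).
Qed.

Lemma continuous_sqmod F : ccontinuous F -> continuous (fun x => sqmod (F x)).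
Proof.
by move=> cF; under [X in continuous X]funext do rewrite -dotzz; exact: continuous_dot.
Qed.

Lemma continuousM_fun (f g : R -> R) : continuous f -> continuous g ->
  continuous (fun x => f x * g x).
Proof. by move=> cf cg x; apply: cvgM; [exact: cf|exact: cg]. Qed.

Lemma continuousD_fun (f g : R -> R) : continuous f -> continuous g ->
  continuous (fun x => f x + g x).
Proof. by move=> cf cg x; apply: cvgD; [exact: cf|exact: cg]. Qed.

Lemma continuous_cst_fun k : continuous (fun _ : R => k).
Proof. by move=> x; exact: cvg_cst. Qed.

End PlaneVectors.

Section Characters.
Context {R : realType}.
Implicit Types (F G W : R -> R[i]).

(** The sign is that of the Dirichlet polynomials at [s = i x]. *)
Definition chr (n : nat) (x : R) : R[i] := (cos (n%:R * x) -i* sin (n%:R * x))%C.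

Lemma chrD n m x : chr (n + m) x = chr n x * chr m x.
Proof.
rewrite /chr natrD mulrDl cosD sinD; apply/eqP; rewrite eq_complex/=.
by apply/andP; split; apply/eqP; ring.
Qed.

Lemma sqmod_chr n x : sqmod (chr n x) = 1.
Proof. by rewrite /sqmod /chr /= sqrrN cos2Dsin2. Qed.

Lemma chr_periodic n x : chr n (x + 2 * pi) = chr n x.
Proof.
elim: n => [|n ih]; first by rewrite /chr !mul0r.
rewrite -addn1 !chrD ih; congr (_ * _).
by rewrite /chr !mul1r mulr_natl cosD2pi sinD2pi.
Qed.

Lemma ccontinuous_chr n : ccontinuous (chr n).
Proof.
have cn : continuous (fun x : R => n%:R * x).
  by move=> x; apply: cvgM; [exact: cvg_cst|exact: cvg_id].
split => x.
  by apply: continuous_comp; [exact: cn|exact: continuous_cos].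
by apply: cvgN; apply: continuous_comp; [exact: cn|exact: continuous_sin].
Qed.

Definition inner F G : R := mean (fun x => dot (F x) (G x)).

Lemma innerC F G : inner F G = inner G F.
Proof. by congr mean; apply/funext => x; rewrite dotC. Qed.

Lemma innerBr F G G' : ccontinuous F -> ccontinuous G -> ccontinuous G' ->
  inner F (fun x => G x - G' x) = inner F G - inner F G'.
Proof.
move=> cF cG cG'; rewrite /inner.
under [X in mean X]funext do rewrite dotBr -mulN1r.
rewrite meanD ?meanZ ?mulN1r//; try exact: continuous_dot.
by apply: continuousM_fun; [exact: continuous_cst_fun|exact: continuous_dot].
Qed.

Lemma inner_sumr I (s : seq I) F (G : I -> R -> R[i]) :
  ccontinuous F -> (forall i, ccontinuous (G i)) ->
  inner F (fun x => \sum_(i <- s) G i x) = \sum_(i <- s) inner F (G i).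
Proof.
move=> cF cG; rewrite /inner.
under [X in mean X]funext do rewrite dot_sumr.
by rewrite mean_sum// => i; exact: continuous_dot.
Qed.

Lemma innerZr F G (k : R) : ccontinuous F -> ccontinuous G ->
  inner F (fun x => (k%:C * G x)%C) = k * inner F G.
Proof.
move=> cF cG; rewrite /inner; under [X in mean X]funext do rewrite dotZr.
by rewrite meanZ//; exact: continuous_dot.
Qed.

Lemma inner_chr n m : inner (chr n) (chr m) = (n == m)%:R.
Proof.
wlog nm : n m / (m <= n)%N => [H|].
  by have [/H//|/ltnW/H] := leqP m n; rewrite innerC eq_sym.
rewrite /inner (_ : (fun x => _) = fun x : R => cos ((n - m)%:R * x)).
  by rewrite mean_cos subn_eq0 eqn_leq nm andbT.
apply/funext => x; rewrite natrB// mulrBl cosB /dot /chr/=; ring.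
Qed.

Lemma bessel (s : seq nat) W : uniq s -> ccontinuous W ->
  \sum_(n <- s) inner W (chr n) ^+ 2 <= mean (fun x => sqmod (W x)).
Proof.
move=> us cW; pose c n := inner W (chr n).
pose T x := \sum_(n <- s) ((c n)%:C * chr n x)%C.
have cct n : ccontinuous (fun x => ((c n)%:C * chr n x)%C).
  by apply: ccontinuousM; [exact: ccontinuous_cst|exact: ccontinuous_chr].
have cT : ccontinuous T by exact: ccontinuous_sum.
have iWT : inner W T = \sum_(n <- s) c n ^+ 2.
  rewrite inner_sumr//; apply: eq_bigr => n _.
  by rewrite innerZr//; exact: ccontinuous_chr.
have iTT : inner T T = \sum_(n <- s) c n ^+ 2.
  rewrite {2}/T inner_sumr// !big_seq; apply: eq_bigr => n ns.
  rewrite innerZr//; last exact: ccontinuous_chr.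
  rewrite innerC inner_sumr//; last exact: ccontinuous_chr.
  rewrite (bigD1_seq n)//= innerZr; try exact: ccontinuous_chr.
  rewrite inner_chr eqxx mulr1 big1 ?addr0// => m mn.
  by rewrite innerZr ?inner_chr; try exact: ccontinuous_chr; rewrite eq_sym (negbTE mn) mulr0.
have : 0 <= inner (fun x => W x - T x) (fun x => W x - T x).
  by apply: mean_ge0 => x; rewrite dotzz sqmod_ge0.
rewrite innerBr//; last exact: ccontinuousB.
rewrite innerC innerBr// [X in _ - X]innerC innerBr//; try exact: ccontinuousB.
rewrite [inner T W]innerC iWT iTT subrr subr0 subr_ge0.
by under [X in _ <= mean X -> _]funext do rewrite dotzz.
Qed.

Definition exp_sum (s : seq nat) (x : R) : R[i] := \sum_(n <- s) chr n x.

Lemma ccontinuous_exp_sum s : ccontinuous (exp_sum s).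
Proof. by apply: ccontinuous_sum => n; exact: ccontinuous_chr. Qed.

Lemma mean_sqmod_exp_sum s : uniq s ->
  mean (fun x => sqmod (exp_sum s x)) = (size s)%:R.
Proof.
move=> us; under [X in mean X]funext do rewrite -dotzz.
rewrite -[LHS]/(inner (exp_sum s) (exp_sum s)) inner_sumr//;
  [|exact: ccontinuous_exp_sum|exact: ccontinuous_chr].
rewrite -sum1_size natr_sum !big_seq; apply: eq_bigr => n ns.
rewrite innerC inner_sumr; try exact: ccontinuous_chr.
rewrite (bigD1_seq n)//= inner_chr eqxx big1 ?addr0// => m mn.
by rewrite inner_chr eq_sym (negbTE mn).
Qed.

End Characters.

(** * Power means and 2-smoothness *)

Section PowerMean.
Context {R : realType} (p : R).
Hypothesis p1 : 1 < p.
Implicit Types (F G W : R -> R[i]).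

Let p0 : 0 < p. Proof. exact: lt_trans p1. Qed.

(** The exponent of the norms is written [2 * p], so that powers of the modulus
    are powers of the polynomial expression [sqmod]. *)
Definition pmean F : R := mean (fun x => sqmod (F x) `^ p).
Definition pnorm F : R := pmean F `^ (2 * p)^-1.
(** The pairing of [G] with [|F|^(2p-2) F], the norming functional of [F]; it is
    also, up to the factor [2p], the derivative of [pmean] at [F] along [G]. *)
Definition cross F G : R := mean (fun x => sqmod (F x) `^ (p - 1) * dot (F x) (G x)).

Lemma pmean_ge0 F : 0 <= pmean F.
Proof. by apply: mean_ge0 => x; exact: powR_ge0. Qed.

Lemma pnorm_ge0 F : 0 <= pnorm F.
Proof. exact: powR_ge0. Qed.

Lemma pmeanE F : pmean F = pnorm F `^ (2 * p).
Proof. by rewrite -powRrM mulVf ?powRr1 ?pmean_ge0// mulf_neq0// gt_eqF. Qed.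

Lemma continuous_sqmod_powR F (a : R) : 0 < a -> ccontinuous F ->
  continuous (fun x => sqmod (F x) `^ a).
Proof.
move=> a0 cF; apply: continuous_powR_comp => // [|x]; last exact: sqmod_ge0.
exact: continuous_sqmod.
Qed.

Lemma continuous_cross F G : ccontinuous F -> ccontinuous G ->
  continuous (fun x => sqmod (F x) `^ (p - 1) * dot (F x) (G x)).
Proof.
move=> cF cG; apply: continuousM_fun; last exact: continuous_dot.
by apply: continuous_sqmod_powR; rewrite ?subr_gt0.
Qed.

Lemma cross_sum I (s : seq I) F (G : I -> R -> R[i]) :
  ccontinuous F -> (forall i, ccontinuous (G i)) ->
  cross F (fun x => \sum_(i <- s) G i x) = \sum_(i <- s) cross F (G i).
Proof.
move=> cF cG; rewrite /cross.
under [X in mean X]funext do rewrite dot_sumr mulr_sumr.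
by rewrite mean_sum// => i; exact: continuous_cross.
Qed.

Lemma crossD F G G' : ccontinuous F -> ccontinuous G -> ccontinuous G' ->
  cross F (fun x => G x + G' x) = cross F G + cross F G'.
Proof.
move=> cF cG cG'; rewrite /cross.
under [X in mean X]funext do rewrite dotDr mulrDr.
by rewrite meanD//; exact: continuous_cross.
Qed.

Lemma crossZ F G (k : R) : ccontinuous F -> ccontinuous G ->
  cross F (fun x => (k%:C * G x)%C) = k * cross F G.
Proof.
move=> cF cG; rewrite /cross.
under [X in mean X]funext do rewrite dotZr mulrCA.
by rewrite meanZ//; exact: continuous_cross.
Qed.

Lemma crossFF F : cross F F = pmean F.
Proof.
rewrite /cross /pmean; congr mean; apply/funext => x.
by rewrite dotzz mulrC mulr_powRB1// sqmod_ge0.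
Qed.

(** Hoelder's inequality with exponents [2p / (2p - 1)] and [2p]. *)
Lemma cross_le F G : ccontinuous F -> ccontinuous G ->
  cross F G <= pnorm F `^ (2 * p - 1) * pnorm G.
Proof.
have hp := p1; move=> cF cG.
have h2p : 0 < 2 * p by rewrite mulr_gt0.
have a0 : 0 < (2 * p - 1) / (2 * p) by rewrite divr_gt0//; lra.
have a0' : 0 < (2 * p)^-1 * (2 * p - 1) by rewrite mulrC.
have b0 : 0 < (2 * p)^-1 by rewrite invr_gt0.
have ab : (2 * p - 1) / (2 * p) + (2 * p)^-1 = 1 by field; rewrite gt_eqF.
have cFp := continuous_sqmod_powR p0 cF; have cGp := continuous_sqmod_powR p0 cG.
have := mean_holder cFp cGp (fun=> powR_ge0 _ _) (fun=> powR_ge0 _ _) a0 b0 ab.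
rewrite -/(pmean F) -/(pmean G) [(2 * p - 1) / _]mulrC (powRrM (pmean F)) -/(pnorm F) -/(pnorm G).
apply: le_trans; apply: le_mean.
- exact: continuous_cross.
- by apply: continuousM_fun; apply: continuous_powR_comp => // x; exact: powR_ge0.
move=> x; rewrite -!powRrM.
have -> : p * ((2 * p)^-1 * (2 * p - 1)) = p - 1 + 2^-1 by field; rewrite gt_eqF.
have -> : p / (2 * p) = 2^-1 by field; rewrite gt_eqF.
rewrite (@powRD _ (sqmod (F x)) (p - 1) 2^-1); last by apply/implyP => /eqP h; exfalso; lra.
rewrite -mulrA; apply: ler_wpM2l; first exact: powR_ge0.
by rewrite !powR12_sqrt ?sqmod_ge0// dot_le_sqrt.
Qed.

(** Interpolation between the [L^2] norm and the sup norm. *)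
Lemma pmean_exp_sum_le s : uniq s -> pmean (exp_sum s) <= (size s)%:R `^ (2 * p - 1).
Proof.
have hp := p1; move=> us; set n : R := (size s)%:R.
have n0 : 0 <= n by exact: ler0n.
have cE : ccontinuous (exp_sum s : R -> R[i]) by exact: ccontinuous_exp_sum.
apply: (@le_trans _ _ (mean (fun x => (n ^+ 2) `^ (p - 1) * sqmod (exp_sum s x)))).
  apply: le_mean => [||x]; first exact: continuous_sqmod_powR.
    by apply: continuousM_fun; [exact: continuous_cst_fun|exact: continuous_sqmod].
  rewrite -(@mulr_powRB1 _ _ p) ?sqmod_ge0// mulrC ler_wpM2r ?sqmod_ge0//.
  apply: ge0_ler_powR; rewrite ?nnegrE ?sqmod_ge0 ?sqr_ge0 ?subr_ge0 ?(ltW p1)//.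
  by rewrite /n; apply: sqmod_sum_le => m; rewrite sqmod_chr.
rewrite meanZ ?mean_sqmod_exp_sum//; last exact: continuous_sqmod.
rewrite -/n -powR_mulrn// -powRrM mulrC -(@mulr_powRB1 _ _ (2 * p - 1))//; last by lra.
by have -> : 2 * (p - 1) = 2 * p - 1 - 1 by ring.
Qed.

Lemma pnorm_exp_sum_le s : uniq s ->
  pnorm (exp_sum s) <= (size s)%:R `^ (1 - (2 * p)^-1).
Proof.
move=> us.
have -> : 1 - (2 * p)^-1 = (2 * p - 1) * (2 * p)^-1 by field; rewrite gt_eqF.
rewrite powRrM; apply: ge0_ler_powR; rewrite ?nnegrE ?pmean_ge0 ?powR_ge0//.
- by rewrite invr_ge0 mulr_ge0 ?ltW.
- exact: pmean_exp_sum_le.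
Qed.

(** One step of the argument that [L^r] is [2]-smooth for [r = 2p >= 2]: adding
    [G] to [F] raises the squared norm by at most a multiple of the squared norm
    of [G], up to the first-order term.  Every use below is arranged so that this
    first-order term is nonpositive or negligible. *)
Lemma pmean_smooth : exists K : R, 1 <= K /\ forall F G (U V : R),
  ccontinuous F -> ccontinuous G -> 0 <= U -> 0 <= V ->
  pmean F <= U `^ p -> pmean G <= V `^ p ->
  pmean (fun x => F x + G x) <= 2 * p * cross F G + (U + K * V) `^ p.
Proof.
have hp := p1; have [C [C1 smooth]] := powR_smooth p1.
have C0 : 0 < C by lra.
have pm1 : 0 < p - 1 by lra.
exists (C + C); split; first by lra.
move=> F G U V cF cG U0 V0 FU GV.
have cFp := continuous_sqmod_powR p0 cF; have cGp := continuous_sqmod_powR p0 cG.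
have cFp1 := continuous_sqmod_powR pm1 cF; have cG1 := continuous_sqmod cG.
have cFG := continuous_cross cF cG.
have holder : mean (fun x => sqmod (F x) `^ (p - 1) * sqmod (G x)) <= U `^ (p - 1) * V.
  have a0 : 0 < (p - 1) / p by rewrite divr_gt0.
  have b0 : 0 < p^-1 by rewrite invr_gt0.
  have ab : (p - 1) / p + p^-1 = 1 by field; rewrite gt_eqF.
  have := mean_holder cFp cGp (fun=> powR_ge0 _ _) (fun=> powR_ge0 _ _) a0 b0 ab.
  have e1 : p * ((p - 1) / p) = p - 1 by field; rewrite gt_eqF.
  under [X in mean X <= _ -> _]funext do
    rewrite -!powRrM e1 mulfV ?gt_eqF// powRr1 ?sqmod_ge0//.
  move/le_trans; apply; apply: ler_pM; rewrite ?powR_ge0//.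
    apply: le_trans (ge0_ler_powR (ltW a0) _ _ FU) _; rewrite ?nnegrE ?pmean_ge0 ?powR_ge0//.
    by rewrite -powRrM e1.
  apply: le_trans (ge0_ler_powR (ltW b0) _ _ GV) _; rewrite ?nnegrE ?pmean_ge0 ?powR_ge0//.
  by rewrite -powRrM mulfV ?gt_eqF// powRr1.
have step1 : pmean (fun x => F x + G x) <=
    pmean F + 2 * p * cross F G + C * (U `^ (p - 1) * V + pmean G).
  have cFG' := continuousM_fun cFp1 cG1.
  have h1 := continuousM_fun (@continuous_cst_fun R (2 * p)) cFG.
  have h2 := continuousD_fun cFG' cGp.
  have h3 := continuousM_fun (@continuous_cst_fun R C) h2.
  have h4 := continuousD_fun cFp h1.
  apply: (@le_trans _ _ (pmean F + 2 * p * cross F G +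
    C * (mean (fun x => sqmod (F x) `^ (p - 1) * sqmod (G x)) + pmean G))).
    rewrite /pmean /cross -meanD// -meanZ// -meanZ// -meanD// -meanD//.
    apply: le_mean => [||x].
    - by apply: continuous_sqmod_powR => //; exact: ccontinuousD.
    - exact: continuousD_fun h4 h3.
    - by rewrite sqmodD; apply: smooth; rewrite ?sqmod_ge0// dot_cauchy.
  by rewrite lerD2l ler_pM2l// lerD2r.
apply: le_trans step1 _.
rewrite [X in X + _ <= _]addrC -addrA lerD2l mulrDr.
have CV : 0 <= C * V by rewrite mulr_ge0// ltW.
apply: (@le_trans _ _ (U `^ p + (C * (U `^ (p - 1) * V) + C * V `^ p))).
  by apply: lerD => //; rewrite lerD2l ler_pM2l.
have CVp : C * V `^ p <= (C * V) `^ p.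
  by rewrite powRM ?(ltW C0)// ler_wpM2r ?powR_ge0// le1r_powR// ltW.
have -> : U + (C + C) * V = (U + C * V) + C * V by ring.
apply: le_trans (powR_superadditive (ltW p1) (addr_ge0 U0 CV) CV).
rewrite addrA; apply: lerD => //.
have [->|Un0] := eqVneq U 0.
  by rewrite !powR0 ?gt_eqF// mul0r mulr0 !add0r powR_ge0.
have Up : 0 < U by rewrite lt_neqAle eq_sym Un0.
apply: le_trans (powR_tangent p1 Up (addr_ge0 U0 CV)).
rewrite lerD2l addrAC subrr add0r.
have := mulr_ge0 CV (powR_ge0 U (p - 1)).
have -> : p * U `^ (p - 1) * (C * V) = p * (C * V * U `^ (p - 1)) by ring.
have -> : C * (U `^ (p - 1) * V) = C * V * U `^ (p - 1) by ring.
by move: (C * V * _) => Z Z0; rewrite ler_peMl// ltW.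
Qed.

End PowerMean.

(** * Sampling and the large spectrum *)

Section Sampling.
Context {R : realType} (p : R).
Hypothesis p1 : 1 < p.
Implicit Types (A S s : seq nat).

Let p0 : 0 < p. Proof. exact: lt_trans p1. Qed.
Let h2p : 0 < 2 * p. Proof. by rewrite mulr_gt0. Qed.

Lemma le_sum_exists (A : seq nat) (c : nat -> R) : A != [::] ->
  \sum_(n <- A) c n <= 0 -> exists2 n, n \in A & c n <= 0.
Proof.
move=> A0 sA; apply/hasP; apply: contraT => /hasPn h.
case: A A0 sA h => // n A _; rewrite big_cons => sA h.
have cn : 0 < c n by rewrite ltNge; apply: h; rewrite inE eqxx.
suff : 0 <= \sum_(j <- A) c j by lra.
rewrite big_seq; apply: sumr_ge0 => j jA.
by rewrite ltW// ltNge; apply: h; rewrite inE jA orbT.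
Qed.

(** The average of [size A] unimodular functions is approximated by the average
    of [m] of them with error [O(1 / sqrt m)].  The terms are selected one at a
    time: the first-order term in the smoothness inequality has average zero over
    the candidates, so for some candidate it is nonpositive. *)
Lemma exp_sum_sample : exists K : R, 1 <= K /\ forall A m, A != [::] ->
  exists s, [/\ size s = m, {subset s <= A} &
    pmean p (fun x => exp_sum s x -
      (((m%:R / (size A)%:R)%:C)%C * exp_sum A x)) <= (4 * K * m%:R) `^ p].
Proof.
have [K [K1 smooth]] := pmean_smooth p1.
exists K; split => // A m A0.
have k0 : 0 < (size A)%:R :> R by rewrite ltr0n lt0n size_eq0.
have cA : ccontinuous (exp_sum A : R -> R[i]) by exact: ccontinuous_exp_sum.
elim: m => [|m [s [sm sA hs]]].
  exists [::]; split => //.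
  rewrite /pmean mul0r; under [X in mean X]funext do
    rewrite /exp_sum big_nil mul0r subr0 sqmod0 powR0 ?gt_eqF//.
  by rewrite mean_cst powR_ge0.
pose F x : R[i] := exp_sum s x - ((m%:R / (size A)%:R)%:C)%C * exp_sum A x.
pose G n x : R[i] := chr n x - (((size A)%:R^-1)%:C)%C * exp_sum A x.
have cZ (k : R) : ccontinuous (fun x : R => (k%:C)%C * exp_sum A x).
  by apply: ccontinuousM; first exact: ccontinuous_cst.
have cF : ccontinuous F.
  by apply: ccontinuousB => //; exact: ccontinuous_exp_sum.
have cG n : ccontinuous (G n).
  by apply: ccontinuousB => //; exact: ccontinuous_chr.
have [n nA cn] : exists2 n, n \in A & cross p F (G n) <= 0.
  apply: le_sum_exists => //; rewrite -cross_sum// /cross.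
  rewrite (_ : (fun x => _) = fun=> 0) ?mean_cst//; apply/funext => x.
  rewrite (_ : \sum_(i <- A) G i x = 0) ?dot0r ?mulr0//.
  rewrite sumrB -/(exp_sum A x) big_const_seq count_predT iter_addr_0.
  rewrite -mulrnAl -(rmorphMn (real_complex R))/= -[_^-1 *+ _]mulr_natr.
  by rewrite mulVf ?gt_eqF// mul1r subrr.
have GV : pmean p (G n) <= 4 `^ p.
  rewrite -[leRHS]mean_cst; apply: le_mean => [||x].
  - exact: continuous_sqmod_powR.
  - exact: continuous_cst_fun.
  apply: ge0_ler_powR; rewrite ?nnegrE ?sqmod_ge0 ?(ltW p0)//.
  apply: le_trans (sqmodDle _ _) _; rewrite sqmod_chr sqmodN sqmodZ.
  have : sqmod (exp_sum A x) <= (size A)%:R ^+ 2.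
    by apply: sqmod_sum_le => j; rewrite sqmod_chr.
  move=> h; have : (size A)%:R^-1 ^+ 2 * sqmod (exp_sum A x) <= 1.
    by rewrite exprVn mulrC ler_pdivrMr ?mul1r// exprn_gt0.
  by lra.
have U0 : 0 <= 4 * K * m%:R by rewrite !mulr_ge0//; lra.
have := smooth F (G n) _ 4 cF (cG n) U0 (ler0n _ _) hs GV.
move=> h; exists (n :: s); split.
- by rewrite /= sm.
- by move=> j; rewrite inE => /predU1P[->//|]; exact: sA.
rewrite (_ : (fun x => _) = fun x => F x + G n x); last first.
  apply/funext => x; rewrite /F /G /exp_sum big_cons -natr1 mulrDl mul1r rmorphD/=.
  by ring.
apply: le_trans h _.
have -> : 4 * K * m.+1%:R = 4 * K * m%:R + K * 4 by rewrite -natr1; ring.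
by rewrite -[leRHS]add0r; apply: lerD => //; rewrite pmulr_rle0// mulr_gt0.
Qed.

(** Let [F] be the sum over the sample [s], a good approximation to a multiple of
    [exp_sum A], whose norm is [D].  Pairing exponential sums with [|F|^(2p-2) F]
    shows that the part of [A] inside the large spectrum of this function still
    has norm [D / 6], because the coefficients outside it are too small to
    matter; and that the whole spectrum [S] is small, because [exp_sum S] has norm
    at most [(size S)^(1 - 1/2p)]. *)
Lemma large_spectrum : exists K : R, 1 <= K /\ forall A m, uniq A -> A != [::] ->
  (0 < m)%N ->
  3 * Num.sqrt (4 * K * m%:R) <= m%:R / (size A)%:R * pnorm p (exp_sum A) ->
  exists s, [/\ size s = m, {subset s <= A},
    pnorm p (exp_sum A) / 6 <= pnorm p (exp_sum [seq n <- A |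
       pmean p (exp_sum s) / (4 * m%:R) <= cross p (exp_sum s) (chr n)]) &
    forall S, uniq S ->
      {in S, forall n, pmean p (exp_sum s) / (4 * m%:R) <= cross p (exp_sum s) (chr n)} ->
      (size S)%:R <= (6 * (size A)%:R / pnorm p (exp_sum A)) `^ (2 * p)].
Proof.
have hp := p1; have [K [K1 sample]] := exp_sum_sample.
have arith1 (x y z : R) : 3 * z <= x -> x <= y + z -> 2 / 3 * x <= y /\ z <= y / 2.
  by move=> *; split; lra.
have arith2 (x a b c P d : R) :
  x = P * d -> x = a + b -> b <= c -> c <= P * (d / 2) -> x / 2 <= a by lra.
have arith3 (x mu P d N s1 s2 q : R) : x = P * d -> mu * q = x / 4 ->
  mu * s1 <= mu * (P * N) -> mu * s2 <= mu * q -> x / 2 <= mu * (s1 + s2) ->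
  P * (d / 4) <= P * (mu * N) by lra.
have arith4 (d mu D y : R) : d / 4 <= y -> 2 / 3 * (mu * D) <= d -> mu * (D / 6) <= y.
  by lra.
exists K; split => // A m uA A0 m0 hD.
have [s [sm sA hs]] := sample A m A0.
set F : R -> R[i] := exp_sum s; set f : R -> R[i] := exp_sum A in hs hD *.
set D := pnorm p f in hD *; set k : R := (size A)%:R in hs hD *.
set M : R := m%:R in hs hD *; set eta := Num.sqrt _ in hD.
pose thr := pmean p F / (4 * M).
have k0 : 0 < k by rewrite ltr0n lt0n size_eq0.
have M0 : 0 < M by rewrite ltr0n.
have mu0 : 0 < M / k by rewrite divr_gt0.
have eta0 : 0 < eta by rewrite sqrtr_gt0 !mulr_gt0//; lra.
have cf : ccontinuous f by exact: ccontinuous_exp_sum.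
have cF : ccontinuous F by exact: ccontinuous_exp_sum.
have cmf : ccontinuous (fun x : R => ((M / k)%:C)%C * f x).
  by apply: ccontinuousM => //; exact: ccontinuous_cst.
pose w x := F x - ((M / k)%:C)%C * f x.
pose w' x := ((M / k)%:C)%C * f x - F x.
have cw : ccontinuous w by exact: ccontinuousB.
have cw' : ccontinuous w' by exact: ccontinuousB.
have etaE (x : R) : 0 <= x -> (x `^ p) `^ (2 * p)^-1 = Num.sqrt x.
  move=> x0; rewrite -powRrM -powR12_sqrt//; congr (_ `^ _).
  by field; rewrite gt_eqF.
have w_le : pnorm p w <= eta.
  rewrite /eta -etaE ?mulr_ge0//; try lra.
  by apply: ge0_ler_powR; rewrite ?nnegrE ?pmean_ge0 ?powR_ge0 ?invr_ge0 ?(ltW h2p).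
have w'_le : pnorm p w' <= eta.
  apply: le_trans w_le; rewrite /pnorm /pmean (_ : (fun x => _) = (fun x => sqmod (w x) `^ p))//.
  by apply/funext => x; rewrite -[w' x]opprK sqmodN opprB.
have D0 : 0 < D.
  by rewrite -(pmulr_rgt0 _ mu0); apply: lt_le_trans hD; rewrite mulr_gt0.
set D' := pnorm p F.
have DE : pnorm p f = D := erefl.
have D'E : pnorm p F = D' := erefl.
clearbody D D' eta.
have powS (x : R) : 0 <= x -> x `^ (2 * p) = x `^ (2 * p - 1) * x.
  by move=> x0; rewrite [RHS]mulrC mulr_powRB1.
(* Pairing [f] with itself shows that the sample has at least the norm of the
   rescaled [f], up to the sampling error. *)
have D'D : M / k * D <= D' + eta.
  have := crossD p1 cf cF cw'.
  rewrite (_ : (fun x => _) = fun x => ((M / k)%:C)%C * f x); last first.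
    by apply/funext => x; rewrite /w' addrC subrK.
  rewrite crossZ// crossFF// pmeanE// DE powS ?(ltW D0)// => e.
  have := lerD (cross_le p1 cf cF) (cross_le p1 cf cw'); rewrite -e DE D'E.
  rewrite -mulrDr mulrCA ler_pM2l ?(powR_gt0 _ D0)// => /le_trans; apply.
  by rewrite lerD2l.
have [D'1 etaD'] := arith1 _ _ _ hD D'D.
have D'0 : 0 < D' by apply: lt_le_trans D'1; rewrite (mulr_gt0 _ (mulr_gt0 mu0 D0))// divr_gt0.
have P0 : 0 < D' `^ (2 * p - 1) by exact: (powR_gt0 _ D'0).
have pmF : pmean p F = D' `^ (2 * p - 1) * D'   by rewrite (pmeanE p1 F) D'E (powS _ (ltW D'0)).
(* Pairing the sample with [f] bounds the average coefficient over [A] below. *)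
have cA : M / k * \sum_(n <- A) cross p F (chr n) >= pmean p F / 2.
  rewrite -cross_sum// => [|n]; last exact: ccontinuous_chr.
  rewrite -/(exp_sum A) -/f -crossZ//.
  have := crossD p1 cF cmf cw.
  rewrite (_ : (fun x => _) = F); last first.
    by apply/funext => x; rewrite /w addrC subrK.
  rewrite crossFF// => e.
  have := cross_le p1 cF cw; rewrite D'E.
  have : D' `^ (2 * p - 1) * pnorm p w <= D' `^ (2 * p - 1) * (D' / 2).
    by rewrite ler_pM2l// (le_trans w_le).
  by move=> h1 h2; exact: arith2 pmF e h2 h1.
have thrE : thr = D' `^ (2 * p - 1) * D' / (4 * M) by rewrite /thr pmF.
have thr0 : 0 < thr by rewrite thrE divr_gt0// mulr_gt0.
exists s; rewrite -/F -/f -/M -/k -/thr; clearbody thr; split => //.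
- set A1 := [seq n <- A | _].
  have small : \sum_(n <- A | ~~ (thr <= cross p F (chr n))) cross p F (chr n) <= k * thr.
    apply: (@le_trans _ _ (\sum_(n <- A | ~~ (thr <= cross p F (chr n))) thr)).
      by apply: ler_sum => n; rewrite -ltNge => /ltW.
    rewrite big_const_seq iter_addr_0 -mulr_natl ler_pM2r// ler_nat.
    exact: count_size.
  have big1 : \sum_(n <- A1) cross p F (chr n) <= D' `^ (2 * p - 1) * pnorm p (exp_sum A1).
    rewrite -cross_sum// => [|n]; last exact: ccontinuous_chr.
    by rewrite -D'E; apply: cross_le => //; exact: ccontinuous_exp_sum.
  move: cA; rewrite (bigID (fun n => thr <= cross p F (chr n)))/= -big_filter -/A1 => cA.
  have : M / k * (k * thr) = pmean p F / 4.
    by rewrite thrE pmF; field; rewrite !gt_eqF.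
  have := ler_wpM2l (ltW mu0) small; have := ler_wpM2l (ltW mu0) big1.
  move=> h1 h2 h3; have := arith3 _ _ _ _ _ _ _ _ pmF h3 h1 h2 cA.
  rewrite ler_pM2l// => h4.
  by rewrite -(ler_pM2l mu0); exact: arith4 h4 D'1.
- move=> S uS hS; set sg : R := (size S)%:R.
  have sg0 : 0 <= sg by exact: ler0n.
  have : sg * thr <= D' `^ (2 * p - 1) * sg `^ (1 - (2 * p)^-1).
    apply: (@le_trans _ _ (\sum_(n <- S) cross p F (chr n))).
      rewrite /sg mulr_natl -(count_predT S) -[leLHS]addr0 -iter_addr -big_const_seq.
      by rewrite !big_seq; apply: ler_sum => n; exact: hS.
    rewrite -cross_sum// => [|n]; last exact: ccontinuous_chr.
    apply: le_trans (cross_le p1 cF _) _; first exact: ccontinuous_exp_sum.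
    by rewrite D'E ler_pM2l// pnorm_exp_sum_le.
  have [->|sgn0] := eqVneq sg 0; first by rewrite powR_ge0.
  have sgp : 0 < sg by rewrite lt_neqAle eq_sym sgn0.
  have Q0 : 0 < sg `^ (1 - (2 * p)^-1) by exact: powR_gt0.
  have sgE : sg = sg `^ (2 * p)^-1 * sg `^ (1 - (2 * p)^-1).
    rewrite -powRD; last by rewrite sgn0 implybT.
    by rewrite addrC subrK powRr1.
  rewrite {1}sgE thrE.
  set a := sg `^ _ in sgE *; set Q := sg `^ _ in Q0 *; set P := D' `^ _ in P0 *.
  have -> : a * Q * (P * D' / (4 * M)) = P * Q * (a * D' / (4 * M)).
    by field; rewrite gt_eqF.
  rewrite -[leRHS]mulr1 ler_pM2l ?mulr_gt0// ler_pdivrMr ?mulr_gt0// mul1r => h.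
  have a0 : 0 <= a by exact: powR_ge0.
  have -> : sg = a `^ (2 * p) by rewrite -powRrM mulVf ?powRr1// gt_eqF.
  apply: ge0_ler_powR; rewrite ?nnegrE ?(ltW h2p)// ?divr_ge0 ?mulr_ge0 ?(ltW k0) ?(ltW D0)//.
  rewrite ler_pdivlMr//.
  have : a * (2 / 3 * (M / k * D)) <= 4 * M by apply: le_trans h; rewrite ler_wpM2l.
  have -> : a * (2 / 3 * (M / k * D)) = (2 * M) / (3 * k) * (a * D).
    by field; rewrite gt_eqF.
  have c0 : 0 < (2 * M) / (3 * k) by rewrite divr_gt0 ?mulr_gt0.
  have -> : 4 * M = (2 * M) / (3 * k) * (6 * k) by field; rewrite gt_eqF.
  by rewrite (ler_pM2l c0).
Qed.

End Sampling.

(** * Double counting *)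

Section Counting.
Local Open Scope set_scope.
Local Open Scope nat_scope.

Lemma card_set_pair (A B : finType) (P : A -> B -> bool) :
  #|[set x : A * B | P x.1 x.2]| = \sum_(a : A) #|[set b | P a b]|.
Proof.
rewrite -sum1_card (eq_bigl (fun x : A * B => P x.1 x.2)); last by move=> x; rewrite inE.
rewrite -(pair_big_dep xpredT P (fun _ _ => 1)) /=.
by apply: eq_bigr => a _; rewrite -sum1_card; apply: eq_bigl => b; rewrite inE.
Qed.

(** Every factor of the falling factorial exceeds [n - q], hence [q]. *)
Lemma leq_expn_ffact q n : 2 * q <= n -> q ^ q <= n ^_ q.
Proof.
move=> qn; rewrite ffact_prod.
rewrite -[X in X ^ _ <= _]/(q) -[X in _ ^ X <= _](card_ord q) -prod_nat_const.
by apply: leq_prod => i _; have := ltn_ord i; lia.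
Qed.

(** A union bound by double counting.  A bad [w] yields many quadruples
    [(w, i, j, y)] with [j] an injective [q]-tuple of indices, off the range of
    [i], such that [(j u, w (j u))] lies in [S w i].  Overwriting [w] at the
    indices [j u] by the free values [y u] does not change [S w i], and the
    quadruple is recovered from the overwritten function together with [i] and
    the points [(j u, w (j u))], for which there are few choices. *)
Lemma card_bad_functions (N L m q sg : nat)
    (S : {ffun 'I_N -> 'I_L} -> {ffun 'I_m -> 'I_N} -> {set 'I_N * 'I_L})
    (Bad : {set {ffun 'I_N -> 'I_L}}) :
  (forall (w w' : {ffun 'I_N -> 'I_L}) (i : {ffun 'I_m -> 'I_N}),
     (forall l, w (i l) = w' (i l)) -> S w i = S w' i) ->
  (forall w i, #|S w i| <= sg) ->
  (forall w, w \in Bad -> exists (i : {ffun 'I_m -> 'I_N}) (J : {set 'I_N}),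
     [/\ 2 * q <= #|J|, forall l, i l \notin J &
         forall j, j \in J -> (j, w j) \in S w i]) ->
  #|Bad| * (q * L) ^ q <= N ^ m * L ^ N * sg ^ q.
Proof.
move=> Sloc Scard hBad.
have leX a b e : a <= b -> a ^ e <= b ^ e.
  by case: e => // e ab; rewrite leq_exp2r.
pose P (w : {ffun 'I_N -> 'I_L})
  (x : {ffun 'I_m -> 'I_N} * ({ffun 'I_q -> 'I_N} * {ffun 'I_q -> 'I_L})) :=
  [&& injectiveb x.2.1, [forall l, forall u, x.1 l != x.2.1 u] &
      [forall u, (x.2.1 u, w (x.2.1 u)) \in S w x.1]].
pose Q (a : {ffun 'I_N -> 'I_L} * {ffun 'I_m -> 'I_N})
  (v : {ffun 'I_q -> 'I_N * 'I_L}) := [forall u, v u \in S a.1 a.2].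
pose X := [set x | P x.1 x.2].
pose Y := [set y | Q y.1 y.2].
have lower : #|Bad| * (q * L) ^ q <= #|X|.
  rewrite card_set_pair -sum_nat_const [leqRHS](bigID (mem Bad)) /=.
  apply: leq_trans (leq_addr _ _); apply: leq_sum => w wB.
  have [i [J [qJ iJ wJ]]] := hBad w wB.
  pose Z := finset.setX [set i] (finset.setX
    [set j : {ffun 'I_q -> 'I_N} in ffun_on (mem J) | injectiveb j]
    (finset.setTfor {ffun 'I_q -> 'I_L})).
  apply: (@leq_trans #|Z|).
    rewrite !cardsX cards1 mul1n cardsT card_ffun !card_ord expnMn.
    apply: leq_mul => //; rewrite card_inj_ffuns_on card_ord.
    exact: leq_expn_ffact.
  apply: subset_leq_card; apply/fintype.subsetP => -[i' [j y]].
  rewrite !inE /= => /andP[/eqP -> /andP[/andP[/ffun_onP jJ ij] _]].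
  rewrite /P /= ij /=; apply/andP; split.
    apply/forallP => l; apply/forallP => u; apply: contraNneq (iJ l) => ->.
    exact: jJ.
  by apply/forallP => u; apply: wJ; exact: jJ.
have upper : #|Y| <= N ^ m * L ^ N * sg ^ q.
  rewrite card_set_pair.
  apply: (@leq_trans (\sum_(a : {ffun 'I_N -> 'I_L} * {ffun 'I_m -> 'I_N}) sg ^ q)).
    apply: leq_sum => a _.
    rewrite (_ : [set b | Q a b] = [set b in ffun_on (mem (S a.1 a.2))]).
      by rewrite cardsE card_ffun_on card_ord; apply: leX; exact: Scard.
    by apply/finset.setP => v; rewrite !inE /Q; apply/forallP/ffun_onP.
  by rewrite sum_nat_const card_prod !card_ffun !card_ord [_ ^ N * _]mulnC.
apply: leq_trans lower (leq_trans _ upper).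
pose over (w : {ffun 'I_N -> 'I_L}) (j : {ffun 'I_q -> 'I_N}) (y : {ffun 'I_q -> 'I_L}) :=
  [ffun x => if [pick u | j u == x] is Some u then y u else w x]
    : {ffun 'I_N -> 'I_L}.
pose f (x : {ffun 'I_N -> 'I_L} *
   ({ffun 'I_m -> 'I_N} * ({ffun 'I_q -> 'I_N} * {ffun 'I_q -> 'I_L}))) :=
  ((over x.1 x.2.2.1 x.2.2.2, x.2.1),
   [ffun u => (x.2.2.1 u, x.1 (x.2.2.1 u))] : {ffun 'I_q -> 'I_N * 'I_L}).
have over_in (w : {ffun 'I_N -> 'I_L}) (j : {ffun 'I_q -> 'I_N})
  (y : {ffun 'I_q -> 'I_L}) u : injective j -> over w j y (j u) = y u.
  move=> ij; rewrite ffunE; case: pickP => [u' /eqP/ij -> //|/(_ u)].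
  by rewrite eqxx.
have over_out (w : {ffun 'I_N -> 'I_L}) (j : {ffun 'I_q -> 'I_N})
  (y : {ffun 'I_q -> 'I_L}) x : (forall u, j u != x) -> over w j y x = w x.
  by move=> h; rewrite ffunE; case: pickP => // u; rewrite (negbTE (h u)).
rewrite -(@card_in_imset _ _ f); last first.
  move=> [w [i [j y]]] [w' [i' [j' y']]]; rewrite !inE /P /=.
  move=> /and3P[/injectiveP ij _ _] /and3P[/injectiveP ij' _ _] [] eo -> ev.
  have evu u : (j u, w (j u)) = (j' u, w' (j' u)).
    by have /ffunP/(_ u) := ev; rewrite !ffunE.
  have jj : j = j' by apply/ffunP => u; case: (evu u).
  subst j'.
  have yy : y = y' by apply/ffunP => u; rewrite -(over_in w j y u)// eo over_in.
  subst y'; congr (_, _); apply/ffunP => x.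
  have [/existsP[u /eqP <-]|/existsPn h] := boolP [exists u, j u == x].
    by case: (evu u).
  by rewrite -(over_out w j y)// eo over_out.
apply: subset_leq_card; apply/fintype.subsetP => z /imsetP[[w [i [j y]]]].
rewrite !inE /P /= => /and3P[/injectiveP ij /forallP ij' /forallP wS] ->.
apply/forallP => u; rewrite /= ffunE.
rewrite (Sloc _ w); first exact: wS.
move=> l; rewrite over_out// => u'; rewrite eq_sym.
by have /forallP := ij' l; exact.
Qed.

End Counting.

(** * Numerical parameters *)

Section SampleSize.
Context {R : realType}.

Lemma leq_double_divn d k : (0 < d)%N -> (d <= k)%N -> (k <= 2 * d * (k %/ d))%N.
Proof.
move=> d0 dk; have kd := ltn_ceil k d0.
have q0 : (0 < k %/ d)%N by rewrite divn_gt0.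
apply: leq_trans (ltnW kd) _; rewrite [(2 * d)%N]mulnC -mulnA [leqRHS]mulnC.
by rewrite leq_mul2r mul2n -addnn -addn1 leq_add2l q0 orbT.
Qed.

(** With [b = 2 (1 - t)] the error of a sample of this size from [k] exponentials
    is of the order of [k ^ t]. *)
Definition sample_size (b : R) (k : nat) : nat := (Num.truncn (k%:R `^ b)).+1.

Lemma sample_size_gt (b : R) k : k%:R `^ b <= (sample_size b k)%:R.
Proof. exact/ltW/truncnS_gt. Qed.

Lemma sample_size_le (b : R) k : (sample_size b k)%:R <= k%:R `^ b + 1.
Proof. by rewrite -natr1 lerD2r truncn_le powR_ge0. Qed.

(** As [b < 1], the sample stays negligible against [k] even after multiplication
    by [ln k].  The fraction [k / 144] leaves room below the proportion [k / 36]
    of a violator that lies in the spectrum. *)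
Lemma sample_size_small (b c : R) : 0 <= b -> b < 1 -> 1 <= c ->
  exists K0 : nat, (144 <= K0)%N /\ forall k, (K0 <= k)%N ->
    c * ((sample_size b k)%:R + 1) * (1 + ln k%:R) <= (k %/ 144)%:R.
Proof.
move=> b0 b1 c1; pose d := (1 - b) / 2.
have d0 : 0 < d by rewrite /d; lra.
have V0 : 0 < 1 + d^-1 by rewrite addr_gt0// invr_gt0.
have [B [B0 BE]] : exists B : R, 0 < B /\ B = 3 * 288 by exists (3 * 288); split; lra.
have c0 : 0 < c by lra.
pose Z := B * c * (1 + d^-1).
have Z0 : 0 < Z := mulr_gt0 (mulr_gt0 B0 c0) V0.
exists (maxn 144 (Num.truncn (Z `^ d^-1)).+1); split; first exact: leq_maxl.
move=> k; rewrite geq_max => /andP[k144 kZ].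
have k1 : 1 <= k%:R :> R by rewrite ler1n; lia.
have k0 : 0 < k%:R :> R by lra.
have Zk : Z <= k%:R `^ d.
  have -> : Z = (Z `^ d^-1) `^ d.
    by rewrite -powRrM mulVf ?gt_eqF// (powRr1 (ltW Z0)).
  apply: ge0_ler_powR; rewrite ?nnegrE ?powR_ge0 ?(ltW d0) ?(ltW k0)//.
  by apply: le_trans (ltW (truncnS_gt _)) _; rewrite ler_nat.
have kb1 : 1 <= k%:R `^ b by have := ler_powR k1 b0; rewrite powRr0.
have kd1 : 1 <= k%:R `^ d by have := ler_powR k1 (ltW d0); rewrite powRr0.
have h1 : (sample_size b k)%:R + 1 <= 3 * k%:R `^ b.
  have := sample_size_le b k; lra.
have h2 : 1 + ln k%:R <= (1 + d^-1) * k%:R `^ d.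
  have : ln (k%:R `^ d) < k%:R `^ d by apply: ln_sublinear; exact: powR_gt0.
  rewrite ln_powR mulrC -ltr_pdivlMr// mulrDl mul1r [d^-1 * _]mulrC.
  lra.
have q1 : k%:R / 288 <= (k %/ 144)%:R :> R.
  rewrite ler_pdivrMr// -natrM ler_nat.
  by rewrite mulnC; exact: (@leq_double_divn 144).
apply: le_trans q1.
have ln0 : 0 <= ln (k%:R : R) by exact: ln_ge0.
apply: (@le_trans _ _ (c * (3 * k%:R `^ b) * ((1 + d^-1) * k%:R `^ d))).
  apply: ler_pM => //; rewrite ?mulr_ge0 ?addr_ge0 ?ler0n//; try lra.
  by rewrite ler_pM2l//; lra.
have -> : c * (3 * k%:R `^ b) * ((1 + d^-1) * k%:R `^ d) =
  (k%:R `^ b * k%:R `^ d) * Z / 288 by rewrite /Z BE; field; rewrite gt_eqF.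
have i288 : 0 < 288^-1 :> R by lra.
rewrite (ler_pM2r i288).
have {3}-> : k%:R = (k%:R `^ b * k%:R `^ d) * k%:R `^ d.
  rewrite -!powRD ?(gt_eqF k0) ?implybT//.
  have -> : b + d + d = 1 by rewrite /d; field.
  by rewrite powRr1// ltW.
by rewrite ler_pM2l// mulr_gt0// powR_gt0.
Qed.

(** The numerical inequality behind the union bound: [N ^ m.+1] is at most
    [(N / k) ^ (a q) * exp q], whereas [(sg / (q L)) ^ q] is at most
    [(k / N) ^ (a q) * exp (- 2 q)]. *)
Lemma union_bound_ineq (a c0 : R) (N L m q sg k : nat) :
  0 < a -> 0 <= c0 -> (0 < q)%N -> (0 < k)%N -> (k <= N)%N ->
  c0 * 288 <= expR (- 2) -> (k <= 288 * q)%N ->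
  m.+1%:R <= a * q%:R -> m.+1%:R * ln (k%:R : R) <= q%:R ->
  sg%:R <= c0 * k%:R `^ (1 + a) -> N%:R `^ a <= L%:R ->
  (N ^ m.+1 * sg ^ q < (q * L) ^ q)%N.
Proof.
move=> a0 c00 q0 k0 kN hc kq h1 h2 hsg hL.
have kR : 0 < k%:R :> R by rewrite ltr0n.
have NR : 0 < N%:R :> R by rewrite ltr0n (leq_trans k0).
have qR : 0 < q%:R :> R by rewrite ltr0n.
have LR : 0 < L%:R :> R by apply: lt_le_trans hL; exact: powR_gt0.
pose x := ln (N%:R / k%:R : R).
have x0 : 0 <= x by apply: ln_ge0; rewrite ler_pdivlMr// mul1r ler_nat.
have NE : N%:R = expR (x + ln k%:R) :> R.
  by rewrite expRD !lnK ?posrE ?divr_gt0// divfK// gt_eqF.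
have sgq : sg%:R <= (q%:R * L%:R) * expR (- (2 + a * x)).
  apply: le_trans hsg _.
  have -> : expR (- (2 + a * x)) = expR (- 2) * (k%:R `^ a / N%:R `^ a).
    rewrite opprD expRD; congr (_ * _).
    rewrite -powRN -[k%:R](lnK (_ : k%:R \is Num.pos)) ?posrE//.
    rewrite -[N%:R](lnK (_ : N%:R \is Num.pos)) ?posrE//.
    rewrite -!expRM -expRD /x ln_div ?posrE//; congr expR; ring.
  rewrite powRD; last by rewrite (gt_eqF kR) implybT.
  rewrite (powRr1 (ltW kR)).
  set ka := k%:R `^ a; set Na := N%:R `^ a in hL *.
  have ka0 : 0 < ka by exact: powR_gt0.
  have Na0 : 0 < Na by exact: powR_gt0.
  have -> : q%:R * L%:R * (expR (- 2) * (ka / Na)) =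
    (q%:R * expR (-2)) * (L%:R / Na) * ka by field; rewrite gt_eqF.
  rewrite mulrA ler_pM2r//.
  have kqR : k%:R <= 288 * q%:R :> R by rewrite -natrM ler_nat.
  have s1 : c0 * k%:R <= c0 * (288 * q%:R) by rewrite ler_wpM2l.
  have s2 : c0 * (288 * q%:R) <= q%:R * expR (- 2).
    by rewrite mulrA mulrC ler_pM2l.
  have s3 : q%:R * expR (- 2) <= q%:R * expR (- 2) * (L%:R / Na).
    by rewrite ler_peMr ?mulr_ge0 ?expR_ge0 ?(ltW qR)// ler_pdivlMr// mul1r.
  exact: le_trans s1 (le_trans s2 s3).
rewrite -(ltr_nat R) natrM !natrX natrM NE -expRM_natl.
have qL0 : 0 < (q%:R * L%:R) ^+ q :> R by rewrite exprn_gt0// mulr_gt0.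
apply: (@le_lt_trans _ _ (expR (m.+1%:R * (x + ln k%:R)) *
    ((q%:R * L%:R) * expR (- (2 + a * x))) ^+ q)).
  by rewrite ler_pM2l ?expR_gt0// lerXn2r// nnegrE ?mulr_ge0 ?expR_ge0 ?ler0n.
rewrite exprMn -expRM_natl mulrCA -expRD gtr_pMr// expR_lt1.
have : m.+1%:R * x <= a * q%:R * x by rewrite ler_wpM2r.
nra.
Qed.

End SampleSize.

(** * Minimal violators of the upper bound *)

Section MinimalBadSet.
Context {R : realType} (p : R).
Hypothesis p1 : 1 < p.
Implicit Types (A S s : seq nat).

(** When [s] has [m] elements sampled from a set [A], the elements of [A] have on
    average a coefficient of at least about twice this threshold. *)
Definition in_spectrum s m (n : nat) : bool :=
  pmean p (exp_sum s : R -> R[i]) / (4 * m%:R) <= cross p (exp_sum s) (chr n).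

Lemma exp_sum_perm A A' : perm_eq A A' -> exp_sum A = exp_sum A' :> (R -> R[i]).
Proof. by move=> AA'; apply/funext => x; exact: perm_big. Qed.

Lemma pnorm_exp_sum_le_size A : uniq A -> pnorm p (exp_sum A : R -> R[i]) <= (size A)%:R.
Proof.
move=> uA; apply: le_trans (pnorm_exp_sum_le p1 uA) _.
have [->|s0] := eqVneq (size A) 0%N.
  rewrite powR0//; have : (2 * p)^-1 < 1 by rewrite invf_lt1; have hp := p1; lra.
  by move=> h; rewrite gt_eqF// subr_gt0.
rewrite -[leRHS](@powRr1 _) ?ler0n// ler_powR ?ler1n ?lt0n//.
by rewrite gerBl invr_ge0 mulr_ge0// ltW// (lt_trans _ p1).
Qed.

Lemma inv36_powR (t : R) : 2^-1 <= t -> 36^-1 `^ t <= 6^-1.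
Proof.
move=> t2; have e : 36 = 6 ^+ 2 :> R by ring.
have i6 : 0 <= 6^-1 :> R by rewrite invr_ge0 ler0n.
rewrite e -exprVn -powR_mulrn// -powRrM.
rewrite -[leRHS](powRr1 i6); apply: ger_powR; last by lra.
by rewrite invr_gt0 ltr0n/= invf_le1 ?ler1n ?ltr0n.
Qed.

(** In a set of exponentials minimal among those violating [||f_A|| <= C |A|^t],
    the part inside the large spectrum has norm within a factor 6 of the whole,
    so by minimality it contains a fixed proportion of the set: at least [1 / 36]
    of it, since [36 ^ t >= 6]. *)
Lemma minimal_bad_set : exists K : R, 1 <= K /\ forall (C t : R) A m,
  6 <= C -> 36 * K <= C ^+ 2 -> 2^-1 <= t -> uniq A -> A != [::] ->
  (size A)%:R `^ (2 * (1 - t)) <= m%:R ->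
  (forall A', uniq A' -> {subset A' <= A} -> (size A' < size A)%N ->
     pnorm p (exp_sum A') <= C * (size A')%:R `^ t) ->
  C * (size A)%:R `^ t < pnorm p (exp_sum A) ->
  exists s A', [/\ size s = m, {subset s <= A}, uniq A' & {subset A' <= A}] /\
   [/\ (size A <= 36 * size A')%N, {in A', forall n, in_spectrum s m n} &
    forall S, uniq S -> {in S, forall n, in_spectrum s m n} ->
      (size S)%:R <= (6 / C) `^ (2 * p) * (size A)%:R `^ (2 * p * (1 - t))].
Proof.
have hp := p1.
have [K [K1 LS]] := large_spectrum p1; exists K; split => // C t A m C6 CK t2 uA A0 hm hmin hA.
set k : R := (size A)%:R in hm hA *.
set D := pnorm p _ in hA.
have k1 : 1 <= k by rewrite ler1n lt0n size_eq0.
have k0 : 0 < k by lra.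
have C0 : 0 < C by lra.
have t0 : 0 <= t by lra.
have k36 : 0 < k / 36 := divr_gt0 k0 (ltr0Sn _ _).
have kt0 : 0 < k `^ t by exact: powR_gt0.
have D0 : 0 < D by apply: le_lt_trans hA; rewrite mulr_ge0// ltW.
have mR : 0 < m%:R :> R by apply: lt_le_trans hm; exact: powR_gt0.
have m0 : (0 < m)%N by rewrite -(ltr0n R).
(* The sampling error is at most a third of the rescaled norm. *)
have hD : 3 * Num.sqrt (4 * K * m%:R) <= m%:R / k * D.
  have M0 : 0 <= m%:R / k * (C * k `^ t) by rewrite !mulr_ge0 ?invr_ge0// ltW.
  apply: (@le_trans _ _ (m%:R / k * (C * k `^ t))); last first.
    by rewrite ler_pM2l ?divr_gt0// ltW.
  have S0 : 0 <= 3 * Num.sqrt (4 * K * m%:R) by rewrite mulr_ge0 ?sqrtr_ge0.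
  rewrite -(ler_pXn2r (n:=2)) ?nnegrE//.
  rewrite exprMn sqr_sqrtr; last by rewrite !mulr_ge0//; lra.
  have kt : k `^ (2 * (1 - t)) * (k `^ t) ^+ 2 = k ^+ 2.
    rewrite -!powR_mulrn ?powR_ge0 ?(ltW k0)// -powRrM -powRD; last first.
      by rewrite (gt_eqF k0) implybT.
    by congr (_ `^ _); ring.
  rewrite !exprMn exprVn.
  set W := (k `^ t) ^+ 2 in kt *; have W0 : 0 < W by rewrite exprn_gt0.
  have e : m%:R ^+ 2 * k ^- 2 * (C ^+ 2 * W) = m%:R * (C ^+ 2) * ((m%:R * W) / k ^+ 2).
    by field; rewrite gt_eqF.
  rewrite e.
  have h1 : 1 <= (m%:R * W) / k ^+ 2.
    by rewrite ler_pdivlMr ?exprn_gt0// mul1r -kt ler_pM2r.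
  apply: (@le_trans _ _ (m%:R * C ^+ 2)).
    have -> : 3 ^+ 2 * (4 * K * m%:R) = m%:R * (36 * K) by ring.
    by rewrite ler_pM2l.
  by rewrite ler_peMr ?mulr_ge0 ?sqr_ge0// ltW.
have [s [sm sA hA1 hS]] := LS A m uA A0 m0 hD.
set A1 := [seq n <- A | _] in hA1.
exists s, A1; split; split => //.
- exact: filter_uniq.
- by move=> n; rewrite mem_filter => /andP[].
- have A1A : (size A1 <= size A)%N by rewrite size_filter count_size.
  have [A1k|A1k] := ltnP (size A1) (size A); last first.
    by apply: leq_trans A1k _; rewrite leq_pmull.
  have := hmin A1 (filter_uniq _ uA) _ A1k.
  have sub : {subset A1 <= A} by move=> n; rewrite mem_filter => /andP[].
  move=> /(_ sub) hA1'.
  rewrite leqNgt; apply/negP => lt36.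
  have lt36R : (size A1)%:R <= k / 36.
    by rewrite ler_pdivlMr// mulrC -natrM ler_nat ltnW.
  have : (size A1)%:R `^ t <= k `^ t / 6.
    apply: (@le_trans _ _ ((k / 36) `^ t)).
      by apply: (ge0_ler_powR t0); rewrite ?nnegrE ?(ltW k36) ?ler0n.
    rewrite (powRM _ (ltW k0)) ?invr_ge0 ?ler0n// (ler_pM2l kt0).
    exact: inv36_powR.
  move=> h; have : C * (size A1)%:R `^ t <= C * (k `^ t / 6) by rewrite ler_pM2l.
  move: hA1 hA1' hA; rewrite -/D; move: h; clear.
  by move: (k `^ t) (_ `^ t) (pnorm p _) D => x y u v; lra.
- by move=> n; rewrite mem_filter => /andP[].
- move=> S uS hSS; apply: le_trans (hS S uS hSS) _; rewrite -/k -/D.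
  have -> : k `^ (2 * p * (1 - t)) = (k `^ (1 - t)) `^ (2 * p).
    by rewrite -powRrM; congr (_ `^ _); ring.
  have p2 : 0 <= 2 * p := mulr_ge0 (ler0n R 2) (ltW (lt_trans ltr01 hp)).
  have c6 : 0 <= 6 / C := divr_ge0 (ler0n R 6) (ltW C0).
  have x0 : 0 <= 6 * k / D := divr_ge0 (mulr_ge0 (ler0n R 6) (ltW k0)) (ltW D0).
  have y0 : 0 <= 6 / C * k `^ (1 - t) := mulr_ge0 c6 (powR_ge0 _ _).
  rewrite -(powRM _ c6 (powR_ge0 _ _)).
  apply: (ge0_ler_powR p2); rewrite ?nnegrE ?x0 ?y0//.
  rewrite (ler_pdivrMr _ _ D0).
  have kk : k `^ (1 - t) * k `^ t = k.
    rewrite -powRD; last by rewrite (gt_eqF k0) implybT.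
    by rewrite subrK (powRr1 (ltW k0)).
  have e : 6 * k = 6 / C * k `^ (1 - t) * (C * k `^ t).
    by rewrite -{1}kk; field; rewrite (gt_eqF C0).
  have y1 : 0 < 6 / C * k `^ (1 - t) :=
    mulr_gt0 (divr_gt0 (ltr0Sn R 5) C0) (powR_gt0 _ k0).
  by rewrite e (ler_pM2l y1) (ltW hA).
Qed.

End MinimalBadSet.

(** * Random blocks *)

Section Blocks.

Definition place (N L : nat) (x : 'I_N * 'I_L) : nat := (x.1 * L + x.2)%N.

Lemma place_inj N L : injective (@place N L).
Proof.
move=> [i y] [i' y']; rewrite /place /= => e.
have L0 : (0 < L)%N by apply: leq_ltn_trans (ltn_ord y).
have /eqP := congr1 (divn^~ L) e.
rewrite !divnMDl// !divn_small ?ltn_ord// !addn0 => /eqP ii'.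
have /eqP := congr1 (modn^~ L) e; rewrite !modnMDl !modn_small ?ltn_ord// => /eqP yy'.
by congr (_, _); exact: val_inj.
Qed.

Lemma place_lt N L (x : 'I_N * 'I_L) : (place x < N * L)%N.
Proof.
case: x => i y; rewrite /place /=; apply: (@leq_trans (i.+1 * L)).
  by rewrite mulSn addnC ltn_add2r.
by rewrite leq_mul2r ltn_ord orbT.
Qed.

Definition block (N L : nat) (w : {ffun 'I_N -> 'I_L}) : seq nat :=
  [seq place (i, w i) | i <- enum 'I_N].

Lemma size_block N L (w : {ffun 'I_N -> 'I_L}) : size (block w) = N.
Proof. by rewrite size_map size_enum_ord. Qed.

Lemma place_w_inj N L (w : {ffun 'I_N -> 'I_L}) : injective (fun i => place (i, w i)).
Proof. by move=> i j /place_inj[]. Qed.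

Lemma block_uniq N L (w : {ffun 'I_N -> 'I_L}) : uniq (block w).
Proof. by rewrite map_inj_uniq ?enum_uniq//; exact: place_w_inj. Qed.

Lemma blockP N L (w : {ffun 'I_N -> 'I_L}) n :
  reflect (exists i, n = place (i, w i)) (n \in block w).
Proof.
apply: (iffP mapP) => [[i _ ->]|[i ->]]; first by exists i.
by exists i => //; rewrite mem_enum.
Qed.

Lemma block_seq N L (w : {ffun 'I_N -> 'I_L}) (s : seq nat) m :
  size s = m -> {subset s <= block w} -> exists i : {ffun 'I_m -> 'I_N},
    s = [seq place (i l, w (i l)) | l <- enum 'I_m].
Proof.
move=> <- sw.
have h (l : 'I_(size s)) : {i : 'I_N | nth 0%N s l = place (i, w i)}.
  by apply: cid; apply/blockP/sw/mem_nth.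
exists [ffun l => sval (h l)].
apply: (@eq_from_nth _ 0%N); first by rewrite size_map size_enum_ord.
move=> l ls; rewrite (nth_map (Ordinal ls)) ?size_enum_ord// ffunE.
rewrite -(svalP (h _)); congr nth.
by rewrite nth_enum_ord.
Qed.

Lemma card_block_sub N L (w : {ffun 'I_N -> 'I_L}) (A : seq nat) :
  uniq A -> {subset A <= block w} ->
  #|[set i : 'I_N | place (i, w i) \in A]%SET| = size A.
Proof.
move=> uA Aw.
have -> : size A = size [seq place (i, w i) | i <- enum [set i : 'I_N | place (i, w i) \in A]%SET].
  apply/perm_size/uniq_perm => // [|n].
    by rewrite map_inj_uniq ?enum_uniq//; exact: place_w_inj.
  apply/idP/mapP => [nA | [i iA ->] ]; last by move: iA; rewrite mem_enum inE.
  by have /blockP[i e] := Aw n nA; exists i => //; rewrite mem_enum inE -e.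
by rewrite size_map -cardE.
Qed.

End Blocks.

Section RandomBlock.
Context {R : realType} (p t : R).
Hypothesis p1 : 1 < p.
Hypothesis t1 : 2^-1 < t.
Hypothesis t2 : t < 1 - (2 * p)^-1.

Let p0 : 0 < p. Proof. exact: lt_trans p1. Qed.
Let p2 : 0 < 2 * p. Proof. by rewrite mulr_gt0. Qed.
Let a : R := 2 * p * (1 - t) - 1.
Let b : R := 2 * (1 - t).

Let a0 : 0 < a.
Proof.
have hp := p2; have ht := t2.
have h : 2 * p * (2 * p)^-1 < 2 * p * (1 - t) by rewrite ltr_pM2l//; lra.
by move: h; rewrite mulfV ?gt_eqF// /a; lra.
Qed.

(** The union bound.  For [k >= K0] few choice functions [w] admit a sample [i]
    of [sample_size b k] indices whose spectrum, of at most [c0 * k ^ (1 + a)]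
    points, contains the points of the graph of [w] over [2 * (k %/ 144)] further
    indices; for each [k] they are less than the fraction [1 / N] of all functions,
    so those for all [k] together are not everything. *)
Lemma exists_avoiding_function (K0 : nat) (c0 : R) :
  (144 <= K0)%N -> 0 <= c0 -> c0 * 288 <= expR (- 2) ->
  (forall k, (K0 <= k)%N ->
    (1 + a^-1) * ((sample_size b k)%:R + 1) * (1 + ln (k%:R : R)) <= (k %/ 144)%:R) ->
  forall N L, (0 < N)%N -> N%:R `^ a <= L%:R ->
  exists w : {ffun 'I_N -> 'I_L}, forall k, (K0 <= k)%N -> (k <= N)%N ->
  forall (i : {ffun 'I_(sample_size b k) -> 'I_N}) (J : {set 'I_N}),
  (2 * (k %/ 144) <= #|J|)%N -> (forall l, i l \notin J) ->
  #|[set x : 'I_N * 'I_L | in_spectrum p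
      [seq place (i l, w (i l)) | l <- enum 'I_(sample_size b k)] (sample_size b k)
      (place x)]%SET|%:R <= c0 * k%:R `^ (1 + a) ->
  exists2 j, j \in J & ~~ in_spectrum p
      [seq place (i l, w (i l)) | l <- enum 'I_(sample_size b k)] (sample_size b k)
      (place (j, w j)).
Proof.
have reorder (x y z n : nat) : (x * y * z * n = y * (x * n * z))%N by ring.
move=> K144 c00 c0e hK0 N L N0 NL.
pose mk k := sample_size b k.
pose smp k (w : {ffun 'I_N -> 'I_L}) (i : {ffun 'I_(mk k) -> 'I_N}) :=
  [seq place (i l, w (i l)) | l <- enum 'I_(mk k)].
pose spec k w i : {set 'I_N * 'I_L} :=
  [set x | in_spectrum p (smp k w i) (mk k) (place x)]%SET.
pose sg k := Num.truncn (c0 * k%:R `^ (1 + a)).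
(* Oversized spectra are replaced by the empty set, so that the bound on their
   size holds for all [w] and [i], as the count requires. *)
pose S k w i : {set 'I_N * 'I_L} :=
  if (#|spec k w i| <= sg k)%N then spec k w i else finset.set0.
pose bad k (w : {ffun 'I_N -> 'I_L}) :=
  [exists i : {ffun 'I_(mk k) -> 'I_N}, exists J : {set 'I_N},
   [&& (2 * (k %/ 144) <= #|J|)%N, [forall l, i l \notin J] &
       [forall j in J, (j, w j) \in S k w i]]].
have LR : 0 < L%:R :> R by apply: lt_le_trans NL; rewrite powR_gt0// ltr0n.
have L0 : (0 < L)%N by rewrite -(ltr0n R).
have few k : (K0 <= k)%N -> (k <= N)%N ->
    (#|[set w | bad k w]%SET| * N < L ^ N)%N.
  move=> kK kN; set Bad := [set w | _]%SET; set q := (k %/ 144)%N.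
  have q0 : (0 < q)%N by rewrite divn_gt0// (leq_trans K144).
  have k0 : (0 < k)%N by apply: leq_trans kK; apply: leq_trans K144.
  have count : (#|Bad| * (q * L) ^ q <= N ^ mk k * L ^ N * sg k ^ q)%N.
    apply: (@card_bad_functions N L (mk k) q (sg k) (S k)).
    - move=> w w' i ww'.
      have e : smp k w i = smp k w' i by apply: eq_map => l; rewrite ww'.
      by rewrite /S /spec e.
    - by move=> w i; rewrite /S; case: ifP => //; rewrite cards0.
    - move=> w; rewrite inE => /existsP[i /existsP[J /and3P[h1 /forallP h2 /forall_inP h3]]].
      by exists i, J; split.
  have ineq : (N ^ (mk k).+1 * sg k ^ q < (q * L) ^ q)%N.
    have hk := hK0 k kK.
    have lnk : 0 <= ln (k%:R : R) by rewrite ln_ge0// ler1n.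
    have ai : 0 < a^-1 by rewrite invr_gt0.
    have M0 : 0 <= (sample_size b k)%:R + 1 :> R by rewrite addr_ge0 ?ler0n.
    apply: (@union_bound_ineq R a c0 N L (mk k) q (sg k) k) => //.
    - by apply: (@leq_double_divn 144) => //; exact: leq_trans kK.
    - rewrite -natr1 mulrC -ler_pdivrMr// mulrC; apply: le_trans hk.
      have : 0 <= ((sample_size b k)%:R + 1) * (1 + (1 + a^-1) * ln (k%:R : R)).
        by rewrite mulr_ge0// addr_ge0// mulr_ge0// addr_ge0// ltW.
      rewrite /mk; move: M0 lnk ai; clear.
      by move: (_ + 1) (ln _) a^-1 => x y z *; nra.
    - rewrite -natr1; apply: le_trans hk.
      rewrite /mk; move: M0 lnk ai; clear.
      move: (_ + 1) (ln _) a^-1 => x y z x0 y0 z0.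
      have : 0 <= x * y * z by rewrite !mulr_ge0// ltW.
      have : 0 <= x * z by rewrite mulr_ge0// ltW.
      by nra.
    - by rewrite /sg truncn_le mulr_ge0 ?powR_ge0.
  have qL0 : (0 < (q * L) ^ q)%N by rewrite expn_gt0 muln_gt0 q0 L0.
  rewrite -(ltn_pmul2r qL0) mulnAC.
  apply: (@leq_ltn_trans (N ^ mk k * L ^ N * sg k ^ q * N)); first by rewrite leq_mul2r count orbT.
  have -> : (N ^ mk k * L ^ N * sg k ^ q * N = L ^ N * (N ^ (mk k).+1 * sg k ^ q))%N.
    by rewrite expnSr; exact: reorder.
  by rewrite ltn_pmul2l// expn_gt0 L0.
have [w hw] : exists w, forall k, (K0 <= k)%N -> (k <= N)%N -> ~~ bad k w.
  apply: contrapT => /forallNP none.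
  have cover w : (1 <= \sum_(k < N) ((K0 <= k.+1)%N && bad k.+1 w))%N.
    have /existsNP[k /not_implyP[kK /not_implyP[kN /negP/negPn hb]]] := none w.
    have k0 : (0 < k)%N by apply: leq_trans kK; apply: leq_trans K144.
    have kN' : (k.-1 < N)%N by rewrite prednK.
    by rewrite (bigD1 (Ordinal kN'))//= prednK// kK hb.
  have LN0 : (0 < L ^ N)%N by rewrite expn_gt0 L0.
  have : (N * L ^ N <= N * (L ^ N).-1)%N.
    have cardF : #|{ffun 'I_N -> 'I_L}| = (L ^ N)%N by rewrite card_ffun !card_ord.
    rewrite -{1}cardF -sum1_card.
    apply: (@leq_trans (N * \sum_(w : {ffun 'I_N -> 'I_L})
        \sum_(k < N) ((K0 <= k.+1)%N && bad k.+1 w))%N).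
      by rewrite leq_mul2l; apply/orP; right; apply: leq_sum => w _; exact: cover.
    rewrite exchange_big/= big_distrr/=.
    rewrite -[X in (_ <= X * _)%N](card_ord N) -sum_nat_const; apply: leq_sum => k _.
    rewrite -ltnS prednK//.
    have [kK|kK] := leqP K0 k.+1; last first.
      by rewrite big1 ?muln0.
    have -> : \sum_(w : {ffun 'I_N -> 'I_L}) (true && bad k.+1 w : nat) = #|[set w | bad k.+1 w]%SET|.
      by rewrite -sum1_card [RHS]big_mkcond/=; apply: eq_bigr => w _; rewrite inE; case: ifP.
    by rewrite mulnC; apply: few.
  by rewrite leq_mul2l leqNgt prednK// leqnn orbF eqn0Ngt N0.
exists w => k kK kN i J qJ iJ hsg.
have : ~~ bad k w := hw k kK kN.
rewrite negb_exists => /forallP/(_ i); rewrite negb_exists => /forallP/(_ J).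
rewrite qJ /=; have -> /= : [forall l, i l \notin J] by apply/forallP.
rewrite negb_forall => /existsP[j]; rewrite negb_imply => /andP[jJ].
have hs : (#|spec k w i| <= sg k)%N.
  by rewrite /sg truncn_ge_nat// mulr_ge0 ?powR_ge0.
rewrite /S hs inE => hj.
by exists j.
Qed.


(** The sample takes up at most [k / 144] of the at least [k / 36] indices of the
    part [A'] of the block inside the spectrum. *)
Lemma sample_and_spectrum_indices (K0 N L k : nat) (w : {ffun 'I_N -> 'I_L})
    (s A' : seq nat) :
  (144 <= K0)%N -> (K0 <= k)%N ->
  (1 + a^-1) * ((sample_size b k)%:R + 1) * (1 + ln (k%:R : R)) <= (k %/ 144)%:R ->
  size s = sample_size b k -> {subset s <= block w} ->
  uniq A' -> {subset A' <= block w} -> (k <= 36 * size A')%N ->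
  exists (i : {ffun 'I_(sample_size b k) -> 'I_N}) (J : {set 'I_N}),
  [/\ s = [seq place (i l, w (i l)) | l <- enum 'I_(sample_size b k)],
      (2 * (k %/ 144) <= #|J|)%N, forall l, i l \notin J &
      forall j, j \in J -> place (j, w j) \in A'].
Proof.
move=> K144 kK hq sm sw uA' A'w kA'.
have [i si] := block_seq sm sw.
pose T : {set 'I_N} := [set j | place (j, w j) \in A']%SET.
pose I : {set 'I_N} := imset i (mem (finset.setTfor 'I_(sample_size b k))).
exists i, (T :\: I)%SET; split => //.
- have TA : #|T| = size A' := card_block_sub uA' A'w.
  have Im : (#|I| <= sample_size b k)%N.
    by apply: leq_trans (leq_imset_card _ _) _; rewrite cardsT card_ord.
  have mq : (sample_size b k <= k %/ 144)%N.
    rewrite -(ler_nat R); apply: le_trans hq.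
    have lnk : 0 <= ln (k%:R : R).
      by rewrite ln_ge0// ler1n (leq_trans _ kK)// (leq_trans _ K144).
    have ai : 0 < a^-1 by rewrite invr_gt0.
    have := ler0n R (sample_size b k); move: lnk ai; clear.
    move: (_%:R) (ln _) a^-1 => x y z y0 z0 x0.
    have h1 : 1 <= 1 + y by lra.
    have h2 : 1 <= 1 + z by lra.
    apply: (@le_trans _ _ (x + 1)); first by lra.
    have h3 : 0 <= x + 1 by lra.
    apply: (@le_trans _ _ ((1 + z) * (x + 1))); first by rewrite ler_peMl.
    by rewrite ler_peMr// mulr_ge0//; lra.
  have q4 : (4 * (k %/ 144) <= size A')%N.
    rewrite -(@leq_pmul2l 36)// mulnA; apply: leq_trans kA'.
    by rewrite mulnC; exact: leq_trunc_div.
  have TI : (#|T :&: I| <= k %/ 144)%N.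
    by apply: leq_trans (subset_leq_card (finset.subsetIr _ _)) (leq_trans Im mq).
  rewrite cardsD TA; move: q4 TI; clear.
  move: (k %/ 144)%N (size A') #|_ :&: _|%SET => x y z; lia.
- by move=> l; rewrite !inE negb_and negbK imset_f.
- by move=> j; rewrite !inE => /andP[].
Qed.

(** Minimality of a bad subset would put a fixed proportion of it inside the
    spectrum of a small sample of the block, which the choice of [w] excludes. *)
Lemma block_upper : exists C : R, 1 <= C /\ forall N L, (0 < N)%N ->
  N%:R `^ a <= L%:R -> exists w : {ffun 'I_N -> 'I_L},
  forall A, uniq A -> {subset A <= block w} ->
    pnorm p (exp_sum A : R -> R[i]) <= C * (size A)%:R `^ t.
Proof.
have hp := p1; have ht1 := t1; have ht2 := t2.
have hb0 : 0 <= b.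
  have : 0 < (2 * p)^-1 by rewrite invr_gt0.
  by rewrite /b; lra.
have hb1 : b < 1 by rewrite /b; lra.
have ha1 : 1 <= 1 + a^-1 by rewrite lerDl invr_ge0 ltW.
have [K0 [K144 hK0]] := sample_size_small hb0 hb1 ha1.
have [K [K1 hmin]] := minimal_bad_set p1.
have e1 : 1 <= expR 2 :> R by rewrite -expR0 ler_expR.
have K0R := ler0n R K0.
(* [K0] settles the sets with fewer than [K0] elements, [36 * K] makes the sampling
   error small, and the last term makes the spectra small enough for the union
   bound. *)
have [C [C6 C1 CK0 CK Ce]] : exists C : R, [/\ 6 <= C, 1 <= C, K0%:R <= C,
    36 * K <= C & 6 * (288 * expR 2) <= C].
  by exists (K0%:R + 36 * K + 6 * (288 * expR 2)); split; lra.
have C0 : 0 < C := lt_le_trans ltr01 C1.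
pose c0 := (6 / C) `^ (2 * p).
have c00 : 0 <= c0 by exact: powR_ge0.
have c0e : c0 * 288 <= expR (- 2).
  have i1 : 0 < 6 / C := divr_gt0 (ltr0Sn R 5) C0.
  have i2 : 6 / C <= 1 by rewrite ler_pdivrMr// mul1r.
  have i3 : c0 <= 6 / C by apply: ge1r_powR; [rewrite i1 i2|lra].
  have E0 := expR_gt0 (2 : R).
  rewrite expRN -(ler_pM2r E0) mulVf ?gt_eqF// -mulrA.
  have E1 : 0 < 288 * expR 2 :> R := mulr_gt0 (ltr0Sn R 287) E0.
  apply: (@le_trans _ _ (6 / C * (288 * expR 2))); first by rewrite (ler_pM2r E1).
  by rewrite mulrAC ler_pdivrMr// mul1r.
have CK2 : 36 * K <= C ^+ 2.
  by apply: le_trans CK _; rewrite expr2 ler_peMr// ltW.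
exists C; split => // N L N0 NL.
have [w hw] := exists_avoiding_function K144 c00 c0e hK0 N0 NL.
exists w => A; have [n An] := ubnP (size A).
elim: n A An => // n ih A An uA Aw.
have [A0|A0] := eqVneq A [::].
  apply: le_trans (pnorm_exp_sum_le_size p1 uA) _.
  by rewrite A0 mulr_ge0 ?powR_ge0// ltW.
have k0 : (0 < size A)%N by rewrite lt0n size_eq0.
have [kK|kK] := ltnP (size A) K0.
  apply: le_trans (pnorm_exp_sum_le_size p1 uA) _.
  apply: (@le_trans _ _ C); first by apply: le_trans CK0; rewrite ler_nat ltnW.
  rewrite ler_peMr ?(ltW C0)//.
  have k1 : 1 <= (size A)%:R :> R by rewrite ler1n.
  by have := ler_powR k1 (ltW (lt_trans (_ : 0 < 2^-1) t1)); rewrite powRr0; apply; rewrite invr_gt0.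
rewrite leNgt; apply/negP => bad.
have small A' : uniq A' -> {subset A' <= A} -> (size A' < size A)%N ->
    pnorm p (exp_sum A' : R -> R[i]) <= C * (size A')%:R `^ t.
  move=> uA' A'A A'k; apply: ih => //; first exact: leq_trans A'k _.
  by move=> j jA'; exact/Aw/A'A.
have [s [A' [[sm sA uA' A'A] [kA' A's hS]]]] :=
  hmin C t A (sample_size b (size A)) C6 CK2 (ltW t1) uA A0
    (sample_size_gt _ _) small bad.
have sw : {subset s <= block w} by move=> j js; exact/Aw/sA.
have A'w : {subset A' <= block w} by move=> j js; exact/Aw/A'A.
have [i [J [si qJ iJ JA']]] :=
  sample_and_spectrum_indices K144 kK (hK0 _ kK) sm sw uA' A'w kA'.
have kN : (size A <= N)%N.
  by rewrite -(size_block w); apply: uniq_leq_size.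
have [] := hw _ kK kN i J qJ iJ.
  rewrite -si; set X := [set x | _]%SET.
  have := hS [seq place x | x <- enum X].
  rewrite size_map -cardE map_inj_uniq ?enum_uniq; last exact: place_inj.
  have -> : 1 + a = 2 * p * (1 - t) by rewrite /a addrC subrK.
  apply=> // n' /mapP[x]; rewrite mem_enum inE => h ->; exact: h.
by move=> j jJ; rewrite -si A's// JA'.
Qed.

(** Near the origin all the exponentials point in nearly the same direction. *)
Lemma pmean_exp_sum_ge (A : seq nat) (M : nat) :
  (0 < M)%N -> (forall n, n \in A -> (n < M)%N) ->
  ((size A)%:R * cos 1) `^ (2 * p) / M%:R / (2 * pi) <= pmean p (exp_sum A : R -> R[i]).
Proof.
move=> M0 AM; have MR : 0 < M%:R :> R by rewrite ltr0n.
have c1 : 0 < cos 1 :> R := cos1_gt0 R.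
have sc0 : 0 <= (size A)%:R * cos 1 :> R by rewrite mulr_ge0 ?ler0n// ltW.
apply: mean_ge_itv => [||||x /andP[x0 xM]].
- by apply: continuous_sqmod_powR => //; exact: ccontinuous_exp_sum.
- by move=> x; exact: powR_ge0.
- by rewrite invr_ge0 ltW.
- apply: (@le_trans _ _ 1); first by rewrite invf_le1// ler1n.
  by have := @pi_ge2 R; lra.
rewrite powRrM powR_mulrn//.
apply: ge0_ler_powR; rewrite ?nnegrE ?sqmod_ge0 ?sqr_ge0 ?(ltW p0)//.
apply: (@le_trans _ _ (complex.Re (exp_sum A x) ^+ 2)); last first.
  by rewrite lerDl sqr_ge0.
have ReE : complex.Re (exp_sum A x) = \sum_(n <- A) cos (n%:R * x).
  by rewrite /exp_sum raddf_sum.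
have sumge : (size A)%:R * cos 1 <= \sum_(n <- A) cos (n%:R * x).
  rewrite mulr_natl -(count_predT A) -[leLHS]addr0 -iter_addr -big_const_seq.
  rewrite !big_seq; apply: ler_sum => n nA.
  have nx0 : 0 <= n%:R * x by rewrite mulr_ge0.
  have nx1 : n%:R * x <= 1.
    apply: (@le_trans _ _ (M%:R * M%:R^-1)); last by rewrite mulfV ?gt_eqF.
    by apply: ler_pM => //; rewrite ler_nat ltnW// AM.
  have pi1 : 1 <= pi :> R by have := @pi_ge2 R; lra.
  have [->//|ne] := eqVneq (n%:R * x) 1.
  apply: ltW; rewrite ltr_cos ?in_itv/= ?nx0 ?ler01 ?pi1 ?(le_trans nx1)//.
  by rewrite lt_neqAle ne.
by rewrite ReE lerXn2r// nnegrE (le_trans sc0).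
Qed.

Lemma random_block : exists C c : R, [/\ 1 <= C, 0 < c & forall N, (0 < N)%N ->
  exists B, [/\ size B = N, uniq B,
    forall A, uniq A -> {subset A <= B} ->
      pnorm p (exp_sum A : R -> R[i]) <= C * (size A)%:R `^ t &
    c * N%:R `^ t <= pnorm p (exp_sum B : R -> R[i])]].
Proof.
have [C [C1 up]] := block_upper.
have pi0 : 0 < 4 * pi :> R := mulr_gt0 (ltr0Sn R 3) (pi_gt0 R).
have cc0 : 0 < cos 1 `^ (2 * p) / (4 * pi) :> R.
  by rewrite divr_gt0// powR_gt0// cos1_gt0.
exists C, ((cos 1 `^ (2 * p) / (4 * pi)) `^ (2 * p)^-1); split => //.
  exact: powR_gt0.
move=> N N0; pose L := sample_size a N.
have [w hw] := up N L N0 (sample_size_gt _ _).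
exists (block w); split; rewrite ?size_block ?block_uniq//.
have NR : 0 < N%:R :> R by rewrite ltr0n.
have L0 : (0 < L)%N by [].
have NL0 : (0 < N * L)%N by rewrite muln_gt0 N0.
have low := @pmean_exp_sum_ge (block w) (N * L) NL0.
have {}low : (N%:R * cos 1) `^ (2 * p) / (N * L)%:R / (2 * pi) <=
    pmean p (exp_sum (block w) : R -> R[i]).
  move: low; rewrite size_block; apply => n /blockP[i ->].
  exact: place_lt.
have Lle : L%:R <= 2 * N%:R `^ a.
  have N1 : 1 <= N%:R :> R by rewrite ler1n.
  have := ler_powR N1 (ltW a0); rewrite powRr0.
  by have := sample_size_le a N; rewrite -/L; lra.
have main : (cos 1 `^ (2 * p) / (4 * pi)) * N%:R `^ (2 * p * t) <=
    pmean p (exp_sum (block w) : R -> R[i]).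
  apply: le_trans low.
  rewrite powRM ?ler0n ?(ltW (cos1_gt0 R))//.
  have -> : 2 * p = 2 * p * t + (1 + a) by rewrite /a; ring.
  rewrite [N%:R `^ (_ + _)]powRD; last by rewrite (gt_eqF NR) implybT.
  rewrite [N%:R `^ (1 + a)]powRD; last by rewrite (gt_eqF NR) implybT.
  rewrite (powRr1 (ltW NR)) natrM.
  have -> : 2 * p * t + (1 + a) = 2 * p by rewrite /a; ring.
  have P0 : 0 < pi :> R := pi_gt0 R.
  have LR : 0 < L%:R :> R by rewrite ltr0n.
  have X0 : 0 <= N%:R `^ (2 * p * t) * cos 1 `^ (2 * p) / (2 * pi).
    by rewrite divr_ge0 ?mulr_ge0 ?powR_ge0// ltW.
  move: X0; move: (N%:R `^ (2 * p * t)) (cos 1 `^ (2 * p)) (N%:R `^ a) Lle LR NR P0.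
  clear; move: (L%:R : R) (N%:R : R) (pi : R) => l n q x y z lz l0 n0 q0 X0.
  have -> : y / (4 * q) * x = x * y / (2 * q) * 2^-1 by field; rewrite gt_eqF.
  have -> : x * (n * z) * y / (n * l) / (2 * q) = x * y / (2 * q) * (z / l).
    by field; rewrite !gt_eqF.
  by rewrite ler_wpM2l// ler_pdivlMr//; lra.
have -> : N%:R `^ t = (N%:R `^ (2 * p * t)) `^ (2 * p)^-1.
  by rewrite -powRrM mulrAC mulfV ?mul1r// gt_eqF.
rewrite -powRM ?powR_ge0 ?(ltW cc0)//.
apply: ge0_ler_powR; rewrite ?nnegrE ?pmean_ge0 ?invr_ge0 ?(ltW p2)//.
by rewrite mulr_ge0 ?powR_ge0 ?(ltW cc0).
Qed.

End RandomBlock.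

(** * Gluing the blocks *)

Section Gluing.
Context {R : realType} (p t : R).
Hypothesis p1 : 1 < p.
Hypothesis t1 : 2^-1 < t.
Implicit Types (A B L : seq nat) (F G W : R -> R[i]).

Let p0 : 0 < p. Proof. exact: lt_trans p1. Qed.

Lemma exp_sum_shift x A (y : R) : exp_sum (map (addn x) A) y = chr x y * exp_sum A y.
Proof.
rewrite /exp_sum big_map mulr_sumr; apply: eq_bigr => n _.
by rewrite chrD.
Qed.

Lemma exp_sum_cat A B (y : R) : exp_sum (A ++ B) y = exp_sum A y + exp_sum B y.
Proof. exact: big_cat. Qed.

Lemma pmean_shift x A : pmean p (exp_sum (map (addn x) A) : R -> R[i]) = pmean p (exp_sum A).
Proof.
congr mean; apply/funext => y.
by rewrite exp_sum_shift sqmodM sqmod_chr mul1r.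
Qed.

(** By Bessel's inequality the coefficients of finitely many functions cannot
    all stay bounded away from zero along a long window of frequencies. *)
Lemma small_coefficients (I : finType) (W : I -> R -> R[i]) (X : nat) (e : R) :
  (forall i, ccontinuous (W i)) -> 0 < e ->
  exists2 x, (X <= x)%N & forall i, inner (W i) (chr x) <= e.
Proof.
move=> cW e0; pose T := \sum_i mean (fun x => sqmod (W i x)).
pose n := (Num.truncn (T / e ^+ 2)).+1.
have Tn : T < n%:R * e ^+ 2.
  by rewrite -ltr_pdivrMr ?exprn_gt0// truncnS_gt.
apply: contrapT => none.
have big x : (X <= x)%N -> e ^+ 2 <= \sum_i inner (W i) (chr x) ^+ 2.
  move=> Xx; have /existsNP[i /negP] : ~ forall i, inner (W i) (chr x) <= e.
    by move=> h; apply: none; exists x.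
  rewrite -ltNge => hi.
  rewrite (bigD1 i)//= -[leLHS]addr0; apply: lerD.
    by rewrite lerXn2r ?nnegrE ?(ltW e0) ?(ltW (lt_trans e0 hi))// ltW.
  by apply: sumr_ge0 => j _; exact: sqr_ge0.
have : n%:R * e ^+ 2 <= T.
  apply: (@le_trans _ _ (\sum_(x <- iota X n) \sum_i inner (W i) (chr x) ^+ 2)).
    rewrite -{1}(size_iota X n) mulr_natl -(count_predT (iota X n)) -[leLHS]addr0.
    rewrite -iter_addr -big_const_seq !big_seq; apply: ler_sum => x.
    by rewrite mem_iota => /andP[/big].
  rewrite exchange_big; apply: ler_sum => i _.
  by apply: bessel => //; exact: iota_uniq.
by rewrite leNgt Tn.
Qed.

Definition conjfun G (y : R) : R[i] := (complex.Re (G y) -i* complex.Im (G y))%C.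

Lemma ccontinuous_conjfun G : ccontinuous G -> ccontinuous (conjfun G).
Proof. by move=> [G1 G2]; split => // x; apply: cvgN; exact: G2. Qed.

(** As a function of [x], the first-order term is a Fourier coefficient. *)
Lemma cross_modulate F G x :
  cross p F (fun y => chr x y * G y) =
  inner (fun y => ((sqmod (F y) `^ (p - 1))%:C)%C * (F y * conjfun G y)) (chr x).
Proof.
congr mean; apply/funext => y; rewrite /conjfun; cbv beta.
move: (sqmod (F y) `^ (p - 1)) => k; move: (F y) (chr x y) (G y) => z u v.
by case: z => z1 z2; case: u => u1 u2; case: v => v1 v2; rewrite /dot /=; ring.
Qed.

(** The bound [K |A|^(2t)] on squared norms, the quantities that add up when
    blocks are glued. *)
Definition power_bound (K : R) L : Prop := forall A, uniq A -> {subset A <= L} ->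
  pmean p (exp_sum A : R -> R[i]) <= (K * (size A)%:R `^ (2 * t)) `^ p.

(** Translating [B] by a suitable large [x] makes all first-order terms in the
    smoothness inequality at most [1 / 2p]; since [2t >= 1], the resulting bounds
    on the squared norms add up to a bound of the same form. *)
Lemma glue : exists K0 : R, 0 <= K0 /\ forall (C : R) L B X, 1 <= C -> uniq L ->
  power_bound (K0 * C) L -> uniq B -> power_bound C B ->
  exists2 x, (X <= x)%N & power_bound (K0 * C) (L ++ map (addn x) B).
Proof.
have hp := p1; have [K [K1 smooth]] := pmean_smooth p1.
have t21 : 1 <= 2 * t by have h := t1; lra.
have t2 : 0 <= 2 * t := le_trans ler01 t21.
have K0 : 0 <= K := le_trans ler01 K1.
have K10 : 0 <= K + 1 := addr_ge0 K0 ler01.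
exists (K + 1); split => // C L B X C1 uL gL uB gB.
have C0 : 0 <= C := le_trans ler01 C1.
have p2 : 0 < 2 * p by rewrite mulr_gt0.
pose W (m : (size L).-tuple bool * (size B).-tuple bool) (y : R) : R[i] :=
  ((sqmod (exp_sum (mask m.1 L) y) `^ (p - 1))%:C)%C *
  (exp_sum (mask m.1 L) y * conjfun (exp_sum (mask m.2 B)) y).
have cW m : ccontinuous (W m).
  apply: ccontinuousM.
    apply: ccontinuous_real; apply: continuous_sqmod_powR; rewrite ?subr_gt0//.
    exact: ccontinuous_exp_sum.
  apply: ccontinuousM; first exact: ccontinuous_exp_sum.
  by apply: ccontinuous_conjfun; exact: ccontinuous_exp_sum.
have e0 : 0 < (2 * p)^-1 by rewrite invr_gt0.
have [x Xx hx] := small_coefficients (maxn X (\max_(n <- L) n).+1) cW e0.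
have Lx n : n \in L -> (n < x)%N.
  move=> nL; apply: leq_trans Xx; apply: leq_trans (leq_maxr _ _); rewrite ltnS.
  by rewrite (big_rem n)//= leq_maxl.
exists x; first by apply: leq_trans Xx; exact: leq_maxl.
move=> A uA AL.
pose A1 := [seq n <- L | n \in A]; pose A2 := [seq n <- B | (x + n)%N \in A].
have pA : perm_eq A (A1 ++ map (addn x) A2).
  apply: uniq_perm => // [|n].
    rewrite cat_uniq filter_uniq//= map_inj_uniq ?filter_uniq ?andbT//; last exact: addnI.
    apply/hasPn => n /mapP[j _ ->]; rewrite mem_filter negb_and; apply/orP; right.
    by apply/negP => /Lx; rewrite ltnNge leq_addr.
  rewrite mem_cat mem_filter; apply/idP/idP => [nA|].
    have := AL n nA; rewrite mem_cat => /orP[->|/mapP[j jB e]]; first by rewrite nA.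
    apply/orP; right; rewrite e; apply: map_f; rewrite mem_filter jB andbT.
    by rewrite -e.
  by case/orP => [/andP[]//|/mapP[j]]; rewrite mem_filter => /andP[h _] ->.
rewrite (exp_sum_perm pA) (perm_size pA) size_cat size_map.
have KC : 0 <= (K + 1) * C := mulr_ge0 K10 C0.
have U0 : 0 <= (K + 1) * C * (size A1)%:R `^ (2 * t) := mulr_ge0 KC (powR_ge0 _ _).
have uA1 : uniq A1 by exact: filter_uniq.
have A1L : {subset A1 <= L} by move=> n; rewrite mem_filter => /andP[].
have hA1 := gL A1 uA1 A1L.
have uA2 : uniq A2 by exact: filter_uniq.
have A2B : {subset A2 <= B} by move=> n; rewrite mem_filter => /andP[].
have hA2 := gB A2 uA2 A2B.
have [A20|A20] := eqVneq A2 [::]; first by rewrite A20 /= cats0 addn0.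
have s2 : 1 <= (size A2)%:R :> R by rewrite ler1n lt0n size_eq0.
have V1 : 1 <= C * (size A2)%:R `^ (2 * t).
  by apply: mulr_ege1 => //; have := ler_powR s2 t2; rewrite powRr0.
set U := _ * (size A1)%:R `^ _ in U0 hA1; set V := C * _ in V1 hA2.
have V0 : 0 <= V := le_trans ler01 V1.
pose G y : R[i] := exp_sum (map (addn x) A2) y.
have cG : ccontinuous G by exact: ccontinuous_exp_sum.
have hG : pmean p G <= V `^ p by rewrite /G pmean_shift.
have := smooth (exp_sum A1) G U V (ccontinuous_exp_sum A1) cG U0 V0 hA1 hG.
have -> : (fun y : R => exp_sum A1 y + G y) = exp_sum (A1 ++ map (addn x) A2).
  by apply/funext => y; rewrite exp_sum_cat.
move/le_trans; apply.
have crossle : cross p (exp_sum A1) G <= (2 * p)^-1.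
  have -> : G = fun y => chr x y * exp_sum A2 y by apply/funext => y; exact: exp_sum_shift.
  rewrite cross_modulate.
  have := hx (map_tuple (mem A) (in_tuple L),
             map_tuple (fun n => (x + n)%N \in A) (in_tuple B)).
  by rewrite /W /= -!filter_mask.
have cross1 : 2 * p * cross p (exp_sum A1) G <= V `^ p.
  apply: (@le_trans _ _ 1).
    by have := ler_wpM2l (ltW p2) crossle; rewrite (mulfV (lt0r_neq0 p2)).
  by have := le1r_powR V1 (ltW hp); apply: le_trans.
apply: (@le_trans _ _ (V `^ p + (U + K * V) `^ p)); first by rewrite lerD2r.
have UK0 : 0 <= U + K * V := addr_ge0 U0 (mulr_ge0 K0 V0).
apply: le_trans (powR_superadditive (ltW hp) V0 UK0) _.
have s0 : 0 <= V + (U + K * V) := addr_ge0 V0 UK0.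
have r0 : 0 <= (K + 1) * C * (size A1 + size A2)%:R `^ (2 * t) :=
  mulr_ge0 KC (powR_ge0 _ _).
apply: (ge0_ler_powR (ltW p0)); [by rewrite nnegrE s0|by rewrite nnegrE r0|].
have -> : V + (U + K * V) = (K + 1) * C * ((size A1)%:R `^ (2 * t) + (size A2)%:R `^ (2 * t)).
  by rewrite /U /V; ring.
apply: (ler_wpM2l KC); rewrite natrD.
exact: powR_superadditive t21 (ler0n _ _) (ler0n _ _).
Qed.

End Gluing.

Section IntegerFrequency.
Context {R : realType} (p t : R).
Hypothesis p1 : 1 < p.
Hypothesis t1 : 2^-1 < t.
Hypothesis t2 : t < 1 - (2 * p)^-1.

Let p0 : 0 < p. Proof. exact: lt_trans p1. Qed.
Let p2 : 0 < 2 * p. Proof. by rewrite mulr_gt0. Qed.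

Lemma power_boundP (C : R) (A : seq nat) : 0 <= C ->
  (pmean p (exp_sum A : R -> R[i]) <= (C ^+ 2 * (size A)%:R `^ (2 * t)) `^ p) =
  (pnorm p (exp_sum A : R -> R[i]) <= C * (size A)%:R `^ t).
Proof.
move=> C0; set x := pnorm _ _; set y := C * _.
have y0 : 0 <= y by rewrite mulr_ge0 ?powR_ge0.
have -> : (C ^+ 2 * (size A)%:R `^ (2 * t)) `^ p = y `^ (2 * p).
  rewrite (powRrM y); congr (_ `^ _); rewrite (powR_mulrn _ y0) exprMn; congr (_ * _).
  by rewrite -powR_mulrn ?powR_ge0// -powRrM mulrC.
rewrite (pmeanE p1) -/x; apply/idP/idP => [|h].
  by apply: contraTT; rewrite -!ltNge => h; apply: gt0_ltr_powR; rewrite ?nnegrE ?pnorm_ge0.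
by apply: ge0_ler_powR; rewrite ?nnegrE ?pnorm_ge0 ?(ltW p2).
Qed.

Lemma sorted_ltn_uniq (s : seq nat) : sorted ltn s -> uniq s.
Proof. by apply: sorted_uniq; [exact: ltn_trans|exact: ltnn]. Qed.

(** Blocks of sizes [1, 2, 3, ...] are glued in turn, each stage being a prefix of
    the next, and [lam] enumerates their union in increasing order. *)
Lemma integer_frequency : exists (lam : nat -> nat) (C c : R),
  [/\ {homo lam : m n / (m < n)%N}, 0 < C, 0 < c,
   forall A, uniq A -> pnorm p (exp_sum (map lam A) : R -> R[i]) <= C * (size A)%:R `^ t &
   forall N, (0 < N)%N -> exists A, [/\ uniq A, size A = N &
     c * N%:R `^ t <= pnorm p (exp_sum (map lam A) : R -> R[i])]].
Proof.
have [C [c [C1 c0 blocks]]] := random_block p1 t1 t2.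
have [K0 [K00 hglue]] := glue p1 t1.
have C21 : 1 <= C ^+ 2 by rewrite exprn_ege1.
pose K := K0 * C ^+ 2.
have K_ge0 : 0 <= K by rewrite mulr_ge0// sqr_ge0.
pose inv L := sorted ltn L /\ power_bound p t K L.
pose ext (jL : nat * seq nat) (L' : seq nat) := inv jL.2 -> inv L' /\
  exists x B, [/\ L' = jL.2 ++ map (addn x) B, size B = jL.1.+1 &
    c * jL.1.+1%:R `^ t <= pnorm p (exp_sum B : R -> R[i])].
have extP jL : exists L', ext jL L'.
  case: jL => j L; rewrite /ext /=.
  have [[sL gL]|ninv] := pselect (inv L); last by exists [::].
  have [B0 [sB0 uB0 upB0 loB0]] := blocks j.+1 (ltn0Sn _).
  pose B := sort leq B0.
  have pB : perm_eq B B0 by rewrite /B perm_sort.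
  have uB : uniq B by rewrite (perm_uniq pB).
  have sB : sorted ltn B by rewrite ltn_sorted_uniq_leq uB sort_sorted//; exact: leq_total.
  have gB : power_bound p t (C ^+ 2) B.
    move=> A uA AB; rewrite power_boundP; last by lra.
    by apply: upB0 => // n /AB; rewrite (perm_mem pB).
  have [x Lx gx] := hglue _ L B (\max_(n <- L) n).+1 C21 (sorted_ltn_uniq sL) gL uB gB.
  exists (L ++ map (addn x) B) => _; split; last first.
    by exists x, B; rewrite (perm_size pB) (exp_sum_perm pB) sB0.
  split => //; rewrite sorted_pairwise; last exact: ltn_trans.
  rewrite pairwise_cat -!sorted_pairwise; try exact: ltn_trans.
  rewrite sL /= sorted_map; apply/andP; split.
    apply/allrelP => n m nL /mapP[j' _ ->].
    apply: (@leq_trans x); last exact: leq_addr.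
    apply: leq_trans Lx; rewrite ltnS.
    by rewrite (big_rem n)//= leq_maxl.
  by rewrite (@eq_sorted _ _ ltn)// => n m; rewrite /= ltn_add2l.
have [f hf] := choice extP.
pose Ls := fix Ls j := if j is j'.+1 then f (j', Ls j') else [::].
have invLs j : inv (Ls j).
  elim: j => [|j ih]; last by case: (hf (j, Ls j) ih).
  split => // A uA A0; have {A0} -> : A = [::].
    by case: A {uA} A0 => // n A /(_ n); rewrite inE eqxx => /(_ isT).
  have z : pnorm p (exp_sum [::] : R -> R[i]) = 0.
    apply/le_anti; rewrite pnorm_ge0 andbT.
    exact: pnorm_exp_sum_le_size p1 [::] isT.
  by rewrite (pmeanE p1) z powR0 ?powR_ge0// gt_eqF.
have stepLs j : exists x B, [/\ Ls j.+1 = Ls j ++ map (addn x) B, size B = j.+1 &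
    c * j.+1%:R `^ t <= pnorm p (exp_sum B : R -> R[i])].
  by case: (hf (j, Ls j) (invLs j)).
have prefLs j k : (j <= k)%N -> exists s, Ls k = Ls j ++ s.
  elim: k => [|k ih]; first by rewrite leqn0 => /eqP ->; exists [::]; rewrite cats0.
  rewrite leq_eqVlt => /predU1P[->|/ih[s e]]; first by exists [::]; rewrite cats0.
  by have [x [B [-> _ _]]] := stepLs k; exists (s ++ map (addn x) B); rewrite e catA.
have sizeLs j : (j <= size (Ls j))%N.
  elim: j => // j ih; have [x [B [-> sB _]]] := stepLs j.
  by rewrite size_cat size_map sB leq_addl.
pose lam n := nth 0%N (Ls n.+1) n.
have lamE n k : (n < size (Ls k))%N -> lam n = nth 0%N (Ls k) n.
  move=> nk; rewrite /lam; have [h|h] := leqP n.+1 k.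
    by have [s ->] := prefLs _ _ h; rewrite nth_cat sizeLs.
  by have [s ->] := prefLs _ _ (ltnW h); rewrite nth_cat nk.
have lam_incr : {homo lam : m n / (m < n)%N}.
  move=> m n mn; rewrite (lamE m n.+1); last exact: ltn_trans mn (sizeLs _).
  apply: (sorted_ltn_nth ltn_trans) => //; last 2 first.
    by rewrite inE (ltn_trans mn (sizeLs _)).
  by rewrite inE sizeLs.
  by case: (invLs n.+1).
have lam_inj : injective lam.
  move=> m n e; case: (ltngtP m n) => // /lam_incr; rewrite e ltnn //.
exists lam, (Num.sqrt K + 1), c; split => //.
- move=> A uA; pose J := (\max_(n <- A) n).+1.
  have sub : {subset map lam A <= Ls J}.
    move=> m /mapP[n nA ->].
    have nJ : (n < size (Ls J))%N.
      by apply: leq_trans (sizeLs J); rewrite ltnS (big_rem n)//= leq_maxl.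
    by rewrite (lamE n J)// mem_nth.
  have uA' : uniq (map lam A) by rewrite map_inj_uniq.
  have [_ gJ] := invLs J.
  have : pmean p (exp_sum (map lam A) : R -> R[i]) <=
      (Num.sqrt K ^+ 2 * (size (map lam A))%:R `^ (2 * t)) `^ p.
    by rewrite (sqr_sqrtr K_ge0); exact: gJ.
  rewrite power_boundP ?sqrtr_ge0// size_map.
  move/le_trans; apply; apply: ler_wpM2r; first exact: powR_ge0.
  by rewrite lerDl.
- case=> // j _; have [x [B [e sB lo]]] := stepLs j.
  exists (iota (size (Ls j)) j.+1); split; [exact: iota_uniq|exact: size_iota|].
  have -> : map lam (iota (size (Ls j)) j.+1) = map (addn x) B.
    have sz : size (Ls j.+1) = (size (Ls j) + j.+1)%N by rewrite e size_cat size_map sB.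
    transitivity [seq nth 0%N (Ls j.+1) n | n <- iota (size (Ls j)) j.+1].
      apply/eq_in_map => n; rewrite mem_iota => /andP[_ h].
      by apply: lamE; rewrite sz.
    rewrite map_nth_iota; last by rewrite sz addKn.
    by rewrite e drop_size_cat// take_oversize// size_map sB.
  by rewrite /pnorm pmean_shift.
Qed.

End IntegerFrequency.

(** * Unimodular coefficients *)

Section UnimodularCoefficients.
Context {R : realType} (p : R).
Hypothesis p1 : 1 < p.
Implicit Types (A : seq nat) (E : nat -> R -> R[i]) (G F : R -> R[i]).

Let p0 : 0 < p. Proof. exact: lt_trans p1. Qed.

Lemma sqmod_convex (k : R) (u v : R[i]) : 0 <= k -> k <= 1 ->
  sqmod (u + k%:C%C * v) <= (1 - k) * sqmod u + k * sqmod (u + v).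
Proof.
case: u => a b; case: v => c d k0 k1; rewrite /sqmod /=.
have := mulr_ge0 (mulr_ge0 k0 (_ : 0 <= 1 - k)) (sqr_ge0 c).
have := mulr_ge0 (mulr_ge0 k0 (_ : 0 <= 1 - k)) (sqr_ge0 d).
have k2 : 0 <= 1 - k by lra.
by move=> /(_ k2) h1 /(_ k2) h2; nra.
Qed.

Lemma pmean_convex F G (k : R) : ccontinuous F -> ccontinuous G ->
  0 <= k -> k <= 1 ->
  pmean p (fun x => F x + k%:C%C * G x) <=
  (1 - k) * pmean p F + k * pmean p (fun x => F x + G x).
Proof.
move=> cF cG k0 k1.
have cFG : ccontinuous (fun x => F x + G x) by exact: ccontinuousD.
have cFp := continuous_sqmod_powR p0 cF.
have cFGp := continuous_sqmod_powR p0 cFG.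
have h1 := continuousM_fun (@continuous_cst_fun R (1 - k)) cFp.
have h2 := continuousM_fun (@continuous_cst_fun R k) cFGp.
rewrite /pmean -!meanZ// -meanD//; apply: le_mean => [||x].
- apply: continuous_sqmod_powR => //; apply: ccontinuousD => //.
  by apply: ccontinuousM => //; exact: ccontinuous_cst.
- exact: continuousD_fun.
apply: le_trans (powR_convex p1 k0 k1 (sqmod_ge0 _) (sqmod_ge0 _)).
apply: ge0_ler_powR; rewrite ?nnegrE ?sqmod_ge0 ?(ltW p0)//.
  by rewrite addr_ge0// mulr_ge0 ?sqmod_ge0// subr_ge0.
exact: sqmod_convex.
Qed.

(** A convex function of the coefficients is largest at the vertices of the
    cube, that is, for coefficients [0] and [1]. *)
Lemma pmean_coef01 E (al : nat -> R) (Bd : R) A G :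
  (forall n, ccontinuous (E n)) -> (forall n, 0 <= al n <= 1) -> ccontinuous G ->
  uniq A ->
  (forall A', uniq A' -> {subset A' <= A} ->
     pmean p (fun x => G x + \sum_(n <- A') E n x) <= Bd) ->
  pmean p (fun x => G x + \sum_(n <- A) (al n)%:C%C * E n x) <= Bd.
Proof.
move=> cE al01; elim: A G => [|n A ih] G cG.
  move=> _ /(_ [::] isT (fun n h => h)).
  by under [X in pmean p X <= _ -> _]funext do rewrite big_nil;
     under [X in _ -> pmean p X <= _]funext do rewrite big_nil.
move=> /= /andP[nA uA] hBd.
have cnE : ccontinuous (fun x => (al n)%:C%C * E n x).
  by apply: ccontinuousM => //; exact: ccontinuous_cst.
under [X in pmean p X]funext do rewrite big_cons addrA.
apply: (ih (fun x => G x + (al n)%:C%C * E n x) (ccontinuousD cG cnE) uA) => A' uA' A'A.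
have cS : ccontinuous (fun x => \sum_(m <- A') E m x) by exact: ccontinuous_sum.
under [X in pmean p X]funext do rewrite addrAC.
have /andP[l0 l1] := al01 n.
apply: le_trans (pmean_convex (ccontinuousD cG cS) (cE n) l0 l1) _.
have h0 : pmean p (fun x => G x + \sum_(m <- A') E m x) <= Bd.
  by apply: hBd => // m /A'A mA; rewrite inE mA orbT.
have h1 : pmean p (fun x => G x + \sum_(m <- A') E m x + E n x) <= Bd.
  have -> : (fun x => G x + \sum_(m <- A') E m x + E n x) =
      fun x => G x + \sum_(m <- n :: A') E m x.
    by apply/funext => x; rewrite big_cons [in RHS]addrCA addrC.
  apply: hBd; first by rewrite /= uA' andbT; apply/negP => /A'A; rewrite (negbTE nA).
  by move=> m; rewrite !inE => /predU1P[->|/A'A ->]; rewrite ?eqxx ?orbT.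
have k1 : 0 <= 1 - al n by rewrite subr_ge0.
apply: le_trans (lerD (ler_wpM2l k1 h0) (ler_wpM2l l0 h1)) _.
by rewrite -mulrDl subrK mul1r.
Qed.

(** The triangle inequality up to a constant factor, which is all that is needed
    for finitely many terms. *)
Lemma pmean_quasi F G : ccontinuous F -> ccontinuous G ->
  pmean p (fun x => F x + G x) <= 4 `^ p * (pmean p F + pmean p G).
Proof.
move=> cF cG.
have cFp := continuous_sqmod_powR p0 cF; have cGp := continuous_sqmod_powR p0 cG.
rewrite /pmean -meanD// -meanZ; last exact: continuousD_fun.
apply: le_mean => [||x].
- by apply: continuous_sqmod_powR => //; exact: ccontinuousD.
- by apply: continuousM_fun; [exact: continuous_cst_fun|exact: continuousD_fun].
apply: (@le_trans _ _ ((4 * Num.max (sqmod (F x)) (sqmod (G x))) `^ p)).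
  apply: ge0_ler_powR; rewrite ?nnegrE ?sqmod_ge0 ?(ltW p0)//.
    by rewrite mulr_ge0// le_max sqmod_ge0.
  apply: le_trans (sqmodDle _ _) _.
  have : sqmod (F x) <= Num.max (sqmod (F x)) (sqmod (G x)) by rewrite le_max lexx.
  have : sqmod (G x) <= Num.max (sqmod (F x)) (sqmod (G x)) by rewrite le_max lexx orbT.
  lra.
rewrite powRM// ?le_max ?sqmod_ge0// ler_wpM2l ?powR_ge0//.
by case: (leP (sqmod (F x)) (sqmod (G x))) => _; [rewrite lerDr|rewrite lerDl]; exact: powR_ge0.
Qed.

Lemma pmean_coefN11 E (al : nat -> R) (Bd : R) A :
  (forall n, ccontinuous (E n)) -> (forall n, n \in A -> -1 <= al n <= 1) -> uniq A ->
  (forall A', uniq A' -> {subset A' <= A} ->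
     pmean p (fun x => \sum_(n <- A') E n x) <= Bd) ->
  pmean p (fun x => \sum_(n <- A) (al n)%:C%C * E n x) <= 4 `^ p * (Bd + Bd).
Proof.
move=> cE al1 uA hBd.
have vertex (be : nat -> R) (s : R) : s ^+ 2 = 1 -> (forall n, 0 <= be n <= 1) ->
    pmean p (fun x => \sum_(n <- A) (s * be n)%:C%C * E n x) <= Bd.
  move=> s1 be01.
  have -> : pmean p (fun x => \sum_(n <- A) (s * be n)%:C%C * E n x) =
      pmean p (fun x => 0 + \sum_(n <- A) (be n)%:C%C * E n x).
    congr mean; apply/funext => x.
    have -> : \sum_(n <- A) (s * be n)%:C%C * E n x =
        s%:C%C * \sum_(n <- A) (be n)%:C%C * E n x.
      by rewrite mulr_sumr; apply: eq_bigr => n _; rewrite rmorphM/= mulrA.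
    by rewrite sqmodZ s1 mul1r add0r.
  apply: (pmean_coef01 cE be01 (ccontinuous_cst 0) uA) => A' uA' A'A.
  by under [X in pmean p X]funext do rewrite add0r; exact: hBd.
(* [cut] is the positive part, capped at [1] so that it lies in [[0, 1]] also for
   indices outside [A]. *)
pose cut k : R := Num.min 1 (Num.max 0 k).
have cut01 k : 0 <= cut k <= 1.
  by rewrite /cut ge_min lexx /= le_min ler01/= le_max lexx.
have cutE k : -1 <= k <= 1 -> k = 1 * cut k + (-1) * cut (- k).
  move=> /andP[k1 k2]; rewrite /cut mul1r mulN1r.
  have [k0|k0] := leP 0 k.
    by rewrite (min_idPr k2) max_l ?oppr_le0// min_r// subr0.
  rewrite max_r; last by rewrite oppr_ge0 ltW.
  by rewrite !min_r ?ler01 ?sub0r ?opprK// lerNl.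
have cfam (s : R) be : ccontinuous (fun x => \sum_(n <- A) (s * be n)%:C%C * E n x).
  by apply: ccontinuous_sum => n; apply: ccontinuousM => //; exact: ccontinuous_cst.
have -> : (fun x => \sum_(n <- A) (al n)%:C%C * E n x) =
    fun x => \sum_(n <- A) (1 * cut (al n))%:C%C * E n x +
             \sum_(n <- A) (-1 * cut (- al n))%:C%C * E n x.
  apply/funext => x; rewrite -big_split/= !big_seq; apply: eq_bigr => n nA.
  by rewrite -mulrDl -rmorphD/= -cutE// al1.
apply: le_trans (pmean_quasi (cfam 1 (fun n => cut (al n))) (cfam (-1) (fun n => cut (- al n)))) _.
apply: ler_wpM2l; first exact: powR_ge0.
by apply: lerD; apply: vertex; rewrite ?expr1n ?sqrrN ?expr1n.
Qed.

(** Splitting unimodular coefficients into the positive and negative parts of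
    their real and imaginary parts reduces them to coefficients in [[0, 1]]. *)
Lemma pmean_unimodular E (eps : nat -> R[i]) (Bd : R) A :
  (forall n, ccontinuous (E n)) -> (forall n, n \in A -> sqmod (eps n) = 1) -> uniq A ->
  (forall A', uniq A' -> {subset A' <= A} ->
     pmean p (fun x => \sum_(n <- A') E n x) <= Bd) ->
  pmean p (fun x => \sum_(n <- A) eps n * E n x) <= 4 `^ p * (4 `^ p * (4 * Bd)).
Proof.
move=> cE eps1 uA hBd.
have unit_le (x y : R) : x ^+ 2 + y ^+ 2 = 1 -> -1 <= x <= 1.
  by move=> h; have := sqr_ge0 y; apply: contraTT; rewrite negb_and -!ltNge => /orP[] ?; nra.
have re1 n : n \in A -> -1 <= complex.Re (eps n) <= 1.
  by move=> /eps1; exact: unit_le.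
have im1 n : n \in A -> -1 <= complex.Im (eps n) <= 1.
  by move=> /eps1; rewrite /sqmod addrC; exact: unit_le.
have hr := pmean_coefN11 cE re1 uA hBd.
have hi := pmean_coefN11 cE im1 uA hBd.
have cfam (be : nat -> R) : ccontinuous (fun x => \sum_(n <- A) (be n)%:C%C * E n x).
  by apply: ccontinuous_sum => n; apply: ccontinuousM => //; exact: ccontinuous_cst.
have -> : (fun x => \sum_(n <- A) eps n * E n x) =
    fun x => \sum_(n <- A) (complex.Re (eps n))%:C%C * E n x +
             'i%C * \sum_(n <- A) (complex.Im (eps n))%:C%C * E n x.
  apply/funext => x; rewrite mulr_sumr -big_split/=; apply: eq_bigr => n _.
  by rewrite mulrA -mulrDl; congr (_ * _); case: (eps n) => u v; simpc.
have ci : ccontinuous (fun x => 'i%C * \sum_(n <- A) (complex.Im (eps n))%:C%C * E n x).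
  by apply: ccontinuousM => //; exact: ccontinuous_cst.
apply: le_trans (pmean_quasi (cfam _) ci) _; apply: ler_wpM2l; first exact: powR_ge0.
have -> : pmean p (fun x => 'i%C * \sum_(n <- A) (complex.Im (eps n))%:C%C * E n x) =
    pmean p (fun x => \sum_(n <- A) (complex.Im (eps n))%:C%C * E n x).
  congr mean; apply/funext => x; rewrite sqmodM; congr (_ `^ _).
  by rewrite {1}/sqmod /= expr0n/= add0r expr1n mul1r.
have -> : 4 `^ p * (4 * Bd) = 4 `^ p * (Bd + Bd) + 4 `^ p * (Bd + Bd) by ring.
exact: lerD hr hi.
Qed.

End UnimodularCoefficients.

(** * Hardy norms and democracy functions *)

Section HardyNorm.
Context {R : realType} (r : R).
Hypothesis r2 : 2 < r.

Let rE : 2 * (r / 2) = r. Proof. by field. Qed.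
Let p1 : 1 < r / 2. Proof. by have h := r2; rewrite ltr_pdivlMr// mul1r. Qed.

Lemma cexp_frequency (n : nat) (x : R) : cexp (- (n%:R%:C)%C * (0 +i* x)%C) = chr n x.
Proof.
rewrite /cexp /chr /=; simpc.
by rewrite expR0 !mul1r cosN sinN.
Qed.

Lemma hnormE (lam : nat -> nat) (A : {fset nat}) (a : nat -> R[i]) :
  hnorm r (fun n => (lam n)%:R) A a =
  pnorm (r / 2) (fun x => \sum_(n <- A) a n * chr (lam n) x).
Proof.
pose F (x : R) : R[i] := \sum_(n <- A) a n * chr (lam n) x.
rewrite -[RHS]/(pnorm (r / 2) F).
have cF : ccontinuous F.
  by apply: ccontinuous_sum => n; apply: ccontinuousM; [exact: ccontinuous_cst|exact: ccontinuous_chr].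
have hp : 0 < r / 2 by apply: lt_trans p1.
have integrand (x : R) : ComplexField.Normc.normc
    (dirichlet_poly (fun n => (lam n)%:R) A a (0 +i* x)%C) `^ r = sqmod (F x) `^ (r / 2).
  have -> : dirichlet_poly (fun n => (lam n)%:R) A a (0 +i* x)%C = F x.
    by apply: eq_bigr => n _; rewrite cexp_frequency.
  have -> : ComplexField.Normc.normc (F x) = sqmod (F x) `^ 2^-1.
    by rewrite powR12_sqrt ?sqmod_ge0//; case: (F x).
  by rewrite -powRrM mulrC.
rewrite /hnorm; apply: cvg_lim => //.
have -> : pnorm (r / 2) F = `|pmean (r / 2) F| `^ r^-1.
  by rewrite ger0_norm ?pmean_ge0// /pnorm rE.
have cpow : continuous (fun y : R => `|y| `^ r^-1).
  apply: continuous_powR_comp => [x|x|]; [exact: norm_continuous|exact: normr_ge0|].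
  by have h := r2; rewrite invr_gt0; lra.
pose f T : R := (2 * T)^-1 * \int[lebesgue_measure]_(x in `[- T, T]) (sqmod (F x) `^ (r / 2)).
have cv : f T @[T --> +oo] --> pmean (r / 2) F.
  apply: cvg_symmetric_mean => [|x|x].
  - exact: continuous_sqmod_powR.
  - exact: powR_ge0.
  - by rewrite /F; under eq_bigr do rewrite chr_periodic.
have cvp : `|f T| `^ r^-1 @[T --> +oo] --> `|pmean (r / 2) F| `^ r^-1.
  exact: (cvg_comp _ _ cv (cpow _)).
apply: cvg_trans cvp; apply: near_eq_cvg; near=> T.
have T0 : 0 < T by near: T; exact: nbhs_pinfty_gt.
congr (_ `^ _); rewrite ger0_norm /f.
  by congr (_ * _); apply: eq_Rintegral => x _; rewrite integrand.
by rewrite mulr_ge0 ?invr_ge0 ?mulr_ge0 ?(ltW T0)//; apply: Rintegral_ge0 => x _; exact: powR_ge0.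
Unshelve. all: by end_near. Qed.

End HardyNorm.

Section Democracy.
Context {R : realType}.

Lemma frequency_democracy (r t C c : R) (lam : nat -> nat) : 2 < r ->
  {homo lam : m n / (m < n)%N} -> 0 < C -> 0 < c ->
  (forall A, uniq A ->
     pnorm (r / 2) (exp_sum (map lam A) : R -> R[i]) <= C * (size A)%:R `^ t) ->
  (forall N, (0 < N)%N -> exists A, [/\ uniq A, size A = N &
     c * N%:R `^ t <= pnorm (r / 2) (exp_sum (map lam A) : R -> R[i])]) ->
  0 < t ->
  let lamR n : R := (lam n)%:R in
  exists C' : R, 0 < C' /\ forall N, (0 < N)%N ->
    [/\ c * N%:R `^ t <= upper_democracy r lamR N,
        upper_democracy r lamR N <= upper_super_democracy r lamR N &
        upper_super_democracy r lamR N <= C' * N%:R `^ t].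
Proof.
move=> r2 lam_incr C0 c0 up lo t0 lamR.
have p1 : 1 < r / 2 by rewrite ltr_pdivlMr// mul1r.
have p0 : 0 < r / 2 := lt_trans ltr01 p1.
have pr : 2 * (r / 2) = r by field.
have r0 : 0 < r by lra.
pose D : R := (4 `^ (r / 2) * (4 `^ (r / 2) * 4)) `^ r^-1.
have D0 : 0 < D by rewrite powR_gt0// !mulr_gt0 ?powR_gt0.
exists (D * C); split; first exact: mulr_gt0.
move=> N N0.
have bound (A : {fset nat}) (eps : nat -> R[i]) : (#|` A| <= N)%N ->
    unimodular_on A eps -> hnorm r lamR A eps <= D * C * N%:R `^ t.
  move=> AN ueps; rewrite /lamR (hnormE r2).
  have uA : uniq A := fset_uniq A.
  pose Bd : R := (C * N%:R `^ t) `^ r.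
  have y0 : 0 <= C * N%:R `^ t by rewrite mulr_ge0 ?powR_ge0// ltW.
  have sub A' : uniq A' -> {subset A' <= A} ->
      pmean (r / 2) (fun x : R => \sum_(n <- A') chr (lam n) x) <= Bd.
    move=> uA' A'A.
    have -> : (fun x : R => \sum_(n <- A') chr (lam n) x) = exp_sum (map lam A').
      by apply/funext => x; rewrite /exp_sum big_map.
    rewrite (pmeanE p1) pr; apply: ge0_ler_powR; rewrite ?nnegrE ?pnorm_ge0 ?(ltW r0)//.
    apply: le_trans (up A' uA') _; rewrite ler_pM2l//.
    apply: ge0_ler_powR; rewrite ?nnegrE ?ler0n ?(ltW t0)// ler_nat.
    by apply: leq_trans AN; apply: uniq_leq_size.
  have eps1 n : n \in (A : seq nat) -> sqmod (eps n) = 1.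
    move=> nA; have := ueps n nA; case: (eps n) => a b.
    rewrite /sqmod /= => h.
    have s0 : 0 <= a ^+ 2 + b ^+ 2 by rewrite addr_ge0 ?sqr_ge0.
    by rewrite -[LHS](sqr_sqrtr s0) h expr1n.
  have := pmean_unimodular p1 (fun n => ccontinuous_chr (lam n)) eps1 uA sub.
  move=> h; rewrite /pnorm pr.
  have -> : D * C * N%:R `^ t = (4 `^ (r / 2) * (4 `^ (r / 2) * (4 * Bd))) `^ r^-1.
    have -> : 4 `^ (r / 2) * (4 `^ (r / 2) * (4 * Bd)) =
      (4 `^ (r / 2) * (4 `^ (r / 2) * 4)) * Bd by ring.
    rewrite powRM ?powR_ge0 ?mulr_ge0 ?powR_ge0// -/D -mulrA; congr (_ * _).
    by rewrite /Bd -powRrM mulfV ?gt_eqF// (powRr1 y0).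
  apply: ge0_ler_powR; rewrite ?nnegrE ?pmean_ge0 ?invr_ge0 ?(ltW r0)//.
  by rewrite !mulr_ge0 ?powR_ge0.
have one_unimodular (A : {fset nat}) : unimodular_on A (fun=> 1 : R[i]).
  by move=> n _; rewrite /= expr1n expr0n/= addr0 sqrtr1.
split.
- have [B [uB sB hB]] := lo N N0.
  pose A : {fset nat} := [fset n in B]%fset.
  have pA : perm_eq A B.
    by apply: uniq_perm => // n; rewrite inE.
  apply: le_trans hB _.
  have -> : pnorm (r / 2) (exp_sum (map lam B) : R -> R[i]) = hnorm r lamR A (fun=> 1).
    rewrite /lamR (hnormE r2); congr pnorm; apply/funext => x.
    rewrite /exp_sum big_map -(perm_big _ pA); apply: eq_bigr => n _.
    by rewrite mul1r.
  apply: ub_le_sup.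
    exists (D * C * N%:R `^ t) => _ [A' A'N ->]; exact: bound.
  by exists A => //; rewrite -sB (perm_size pA).
- apply: ge_sup.
    by exists (hnorm r lamR fset0 (fun=> 1)); exists fset0; rewrite ?cardfs0.
  move=> _ [A AN ->]; apply: ub_le_sup.
    by exists (D * C * N%:R `^ t) => _ [A' [eps [A'N ueps ->]]]; exact: bound.
  by exists A, (fun=> 1); split.
- apply: ge_sup; last by move=> _ [A [eps [AN ueps ->]]]; exact: bound.
  exists (hnorm r lamR fset0 (fun=> 1)); exists fset0, (fun=> 1).
  by split; rewrite ?cardfs0.
Qed.

End Democracy.

Theorem proposition3p2 (R : realType) (r r' t : R)
    (hr : 2 < r) (hr' : r^-1 + r'^-1 = 1)
    (ht1 : 2^-1 < t) (ht2 : t < r'^-1) :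
  exists lam : nat -> R,
    [/\ is_frequency lam,
        asymp_equiv (upper_democracy r lam) (upper_super_democracy r lam) &
        asymp_equiv (upper_super_democracy r lam) (fun N : nat => N%:R `^ t)].
Proof.
have p1 : 1 < r / 2 by rewrite ltr_pdivlMr// mul1r.
have t2 : t < 1 - (2 * (r / 2))^-1.
  have -> : 2 * (r / 2) = r by field.
  lra.
have t0 : 0 < t by lra.
have [lam [C [c [lam_incr C0 c0 up lo]]]] := integer_frequency p1 ht1 t2.
exists (fun n => (lam n)%:R).
have [C' [C'0 H]] := frequency_democracy hr lam_incr C0 c0 up lo t0.
split.
- split => [n|m n|[M hM]]; first exact: ler0n.
    by rewrite ler_nat; apply: (leq_mono lam_incr).
  have grow n : (n <= lam n)%N.
    by elim: n => // n ih; apply: leq_ltn_trans ih (lam_incr _ _ (ltnSn n)).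
  have := hM (lam (Num.truncn `|M|).+1)%:R (ex_intro2 _ _ _ I erefl).
  have : `|M| < (lam (Num.truncn `|M|).+1)%:R.
    by apply: lt_le_trans (truncnS_gt _) _; rewrite ler_nat.
  by move=> h1 h2; have := lt_le_trans h1 h2; rewrite ltNge ler_norm.
- exists (c / C'), 1; split => // [|N N0]; first exact: divr_gt0.
  have [h1 h2 h3] := H N N0; rewrite mul1r; split => //.
  apply: le_trans h1; rewrite mulrAC ler_pdivrMr// -mulrA ler_pM2l//.
  by rewrite mulrC.
- exists c, C'; split => // N N0; have [h1 h2 h3] := H N N0; split => //.
  exact: le_trans h1 h2.
Qed.
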